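(* Let $(\Omega,d_\Omega)$ and $(\Psi,d_\Psi)$ be separable metric spaces, $p\in[1,\infty]$, $q\in[1,\infty)$, $\alpha,\beta\in[0,1]$ with $\alpha+\beta\le1$, and $\mathcal{H}=(p,\Omega,d_\Omega,\Psi,d_\Psi)$. The Fused Network Gromov-Wasserstein distance $\mathrm{FNGW}^{\mathcal{H}}_{q,\alpha,\beta}$ is a metric on the collection of $\mathcal{H}$-networks up to weak isomorphism: it is finite, nonnegative, symmetric, satisfies the triangle inequality, and vanishes exactly on pairs of weakly isomorphic $\mathcal{H}$-networks. In particular the Fused Gromov-Wasserstein distance, which is the case $\alpha=0$, is a metric up to weak isomorphism.
   Context: For a separable metric space $(S,d_S)$, $L^p(W,\mu;S)$ is the set of measurable $f:W\to S$ with $\|d_S(f(\cdot),s_0)\|_{L^p(\mu)}<\infty$ for some (equivalently every) $s_0\in S$. An $\mathcal{H}$-network is a 5-tuple $(X,\psi_X,\phi_X,\omega_X,\mu_X)$ with $X$ a Polish space, $\mu_X$ a Borel probability measure on $X$, $\phi_X\in L^p(X\times X,\mu_X\otimes\mu_X;\mathbb{R})$, $\psi_X\in L^p(X,\mu_X;\Psi)$ and $\omega_X\in L^p(X\times X,\mu_X\otimes\mu_X;\Omega)$. With $\mathcal{C}(\mu_X,\mu_Y)$ the set of couplings of $\mu_X$ and $\mu_Y$, $$\mathrm{FNGW}_{q,\alpha,\beta}^{\mathcal{H}}(X,Y)=\tfrac12\inf_{\pi\in\mathcal{C}(\mu_X,\mu_Y)}\Big(\iint_{(X\times Y)^2} \big((1-\alpha-\beta)d_\Psi(\psi_X(x),\psi_Y(y))^q+\alpha\,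 d_\Omega(\omega_X(x,x'),\omega_Y(y,y'))^q+\beta|\phi_X(x,x')-\phi_Y(y,y')|^q\big)^{p/q}\pi(dx\times dy)\,\pi(dx'\times dy')\Big)^{1/p},$$ with the outer $L^p$-norm replaced by an essential supremum over $\pi\otimes\pi$ if $p=\infty$. For $\alpha=0$ this does not involve $\omega_X,\omega_Y$, and is the Fused Gromov-Wasserstein distance between tuples $(X,\psi_X,\phi_X,\mu_X)$. Weak isomorphism of $\mathcal{H}$-networks $X,Y$ (for given $\alpha,\beta$): there exist a Polish space $W$ with Borel probability measure $\mu_W$ and measurable maps $\rho_X:W\to X$, $\rho_Y:W\to Y$ with $(\rho_X)_*\mu_W=\mu_X$, $(\rho_Y)_*\mu_W=\mu_Y$ such that, for $\mu_W\otimes\mu_W$-almost every $(w,w')$: $\psi_X(\rho_X(w))=\psi_Y(\rho_Y(w))$ if $1-\alpha-\beta>0$; $\omega_X(\rho_X(w),\rho_X(w'))=\omega_Y(\rho_Y(w),\rho_Y(w'))$ if $\alpha>0$; and $\phi_X(\rho_X(w),\rho_X(w'))=\phi_Y(\rho_Y(w),\rho_Y(w'))$ if $\beta>0$. *)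

(* Defs.v *)
From HB Require Import structures.
From mathcomp Require Export all_boot all_order all_algebra.
From mathcomp Require Export all_classical all_reals all_analysis.

Set Implicit Arguments.
Unset Strict Implicit.
Unset Printing Implicit Defensive.
Import Order.TTheory GRing.Theory Num.Theory.
Import numFieldNormedType.Exports.

Local Open Scope classical_set_scope.
Local Open Scope ring_scope.

Definition separable_space (T : topologicalType) : Prop :=
  exists2 D : set T, countable D & dense D.

Definition completely_metrizable (R : realType) (T : topologicalType) : Prop :=
  exists (M : metricType R) (h : T -> M) (g : M -> T),
    [/\ cancel h g, cancel g h, continuous h, continuous g &
        forall F : set_system M, ProperFilter F -> cauchy F ->
          exists x : M, F --> x].

Definition polish (R : realType) (T : topologicalType) : Prop :=
  separable_space T /\ completely_metrizable R T.

Notation borel T := (g_sigma_algebraType (@open T)).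

(* The base point of [pp_carrier] (required by [measurableType]) is irrelevant:
   a space carrying a probability measure is nonempty. *)
Record polish_probability_space (R : realType) := PolishProbabilitySpace {
  pp_carrier :> ptopologicalType ;
  pp_polish : polish R pp_carrier ;
  pp_mu : probability (borel pp_carrier) R
}.

(* Borel measurability of [f] does not require [S] to be pointed, unlike
   [measurable_fun] with [g_sigma_algebraType (@open S)] as codomain. *)
Definition in_Lp (R : realType) (d : measure_display) (W : measurableType d)
    (mu : {measure set W -> \bar R}) (p : \bar R) (S : metricType R)
    (f : W -> S) : Prop :=
  (forall B : set S, <<s @open S >> B -> measurable (f @^-1` B)) /\
  exists s0 : S, ('N[mu]_p [(fun w => (mdist (f w) s0)%:E)] < +oo)%E.

Definition image_law (R : realType) (d d' : measure_display)
    (T : measurableType d) (U : measurableType d')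
    (mu : probability T R) (f : T -> U) (nu : probability U R) : Prop :=
  forall A : set U, measurable A -> pushforward mu f A = nu A.

Record Hnetwork (R : realType) (p : \bar R) (Omega Psi : metricType R) :=
  HNetwork {
    hn_space :> polish_probability_space R ;
    psi_ : borel hn_space -> Psi ;
    phi_ : (borel hn_space * borel hn_space)%type -> R^o ;
    omega_ : (borel hn_space * borel hn_space)%type -> Omega ;
    psi_Lp : in_Lp (pp_mu hn_space) p psi_ ;
    phi_Lp : in_Lp (pp_mu hn_space \x pp_mu hn_space)%E p phi_ ;
    omega_Lp : in_Lp (pp_mu hn_space \x pp_mu hn_space)%E p omega_
  }.

Definition couplings (R : realType) (X Y : polish_probability_space R) :
    set (probability (borel X * borel Y)%type R) :=
  [set pi | image_law pi fst (pp_mu X) /\ image_law pi snd (pp_mu Y)].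
Arguments couplings {R} X Y.

Section HNetworks.
Context {R : realType} {p : \bar R} {Omega Psi : metricType R}.
Implicit Types X Y : Hnetwork p Omega Psi.

Definition FNGW_cost (q alpha beta : R) X Y
    (z : (borel X * borel Y) * (borel X * borel Y)) : R :=
  ((1 - alpha - beta) * mdist (psi_ z.1.1) (psi_ z.1.2) `^ q
   + alpha * mdist (omega_ (z.1.1, z.2.1)) (omega_ (z.1.2, z.2.2)) `^ q
   + beta * `|phi_ (z.1.1, z.2.1) - phi_ (z.1.2, z.2.2)| `^ q) `^ q^-1.

(* The outer norm is the L^p norm of the q-th root: for finite p the integrand
   is (FNGW_cost) ^ p = (sum of q-th powers) ^ (p / q). *)
Definition FNGW (q alpha beta : R) X Y : \bar R :=
  ((2^-1)%:E * ereal_inf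
    [set 'N[(pi \x pi)%E]_p [EFin \o @FNGW_cost q alpha beta X Y]
      | pi in couplings X Y])%E.

Definition weakly_isomorphic (alpha beta : R) X Y : Prop :=
  exists (W : polish_probability_space R)
      (rhoX : borel W -> borel X) (rhoY : borel W -> borel Y),
    [/\ measurable_fun setT rhoX, measurable_fun setT rhoY,
        image_law (pp_mu W) rhoX (pp_mu X), image_law (pp_mu W) rhoY (pp_mu Y) &
        \forall w \ae (pp_mu W \x pp_mu W)%E,
          [/\ 0 < 1 - alpha - beta -> psi_ (rhoX w.1) = psi_ (rhoY w.1),
              0 < alpha ->
                omega_ (rhoX w.1, rhoX w.2) = omega_ (rhoY w.1, rhoY w.2) &
              0 < beta ->
                phi_ (rhoX w.1, rhoX w.2) = phi_ (rhoY w.1, rhoY w.2)]].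

End HNetworks.

Record FGW_tuple (R : realType) (p : \bar R) (Psi : metricType R) :=
  FGWTuple {
    fgw_space :> polish_probability_space R ;
    fgw_psi : borel fgw_space -> Psi ;
    fgw_phi : (borel fgw_space * borel fgw_space)%type -> R^o ;
    fgw_psi_Lp : in_Lp (pp_mu fgw_space) p fgw_psi ;
    fgw_phi_Lp : in_Lp (pp_mu fgw_space \x pp_mu fgw_space)%E p fgw_phi
  }.

Definition forget_omega (R : realType) (p : \bar R) (Omega Psi : metricType R)
    (X : Hnetwork p Omega Psi) : FGW_tuple p Psi :=
  FGWTuple (psi_Lp X) (phi_Lp X).

Section FGWTuples.
Context {R : realType} {p : \bar R} {Psi : metricType R}.
Implicit Types X Y : FGW_tuple p Psi.

Definition FGW_cost (q beta : R) X Y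
    (z : (borel X * borel Y) * (borel X * borel Y)) : R :=
  ((1 - beta) * mdist (fgw_psi z.1.1) (fgw_psi z.1.2) `^ q
   + beta * `|fgw_phi (z.1.1, z.2.1) - fgw_phi (z.1.2, z.2.2)| `^ q) `^ q^-1.

Definition FGW (q beta : R) X Y : \bar R :=
  ((2^-1)%:E * ereal_inf
    [set 'N[(pi \x pi)%E]_p [EFin \o @FGW_cost q beta X Y]
      | pi in couplings X Y])%E.

Definition FGW_weakly_isomorphic (beta : R) X Y : Prop :=
  exists (W : polish_probability_space R)
      (rhoX : borel W -> borel X) (rhoY : borel W -> borel Y),
    [/\ measurable_fun setT rhoX, measurable_fun setT rhoY,
        image_law (pp_mu W) rhoX (pp_mu X), image_law (pp_mu W) rhoY (pp_mu Y) &
        \forall w \ae (pp_mu W \x pp_mu W)%E,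
          (0 < 1 - beta -> fgw_psi (rhoX w.1) = fgw_psi (rhoY w.1)) /\
          (0 < beta ->
             fgw_phi (rhoX w.1, rhoX w.2) = fgw_phi (rhoY w.1, rhoY w.2))].

End FGWTuples.

Definition is_metric_up_to (R : realType) (T : Type) (E : T -> T -> Prop)
    (dist : T -> T -> \bar R) : Prop :=
  [/\ forall x y, dist x y \is a fin_num,
      forall x y, (0 <= dist x y)%E,
      forall x y, dist x y = dist y x,
      forall x y z, (dist x z <= dist x y + dist y z)%E &
      forall x y, dist x y = 0%E <-> E x y].

(* Main.v *)
From HB Require Import structures.
From mathcomp Require Import measurable_realfun ess_sup_inf ring lra.
Require Import Defs.
Set Implicit Arguments.
Unset Strict Implicit.
Unset Printing Implicit Defensive.
Import Order.TTheory GRing.Theory Num.Theory.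
Import numFieldNormedType.Exports.
Local Open Scope classical_set_scope.
Local Open Scope ring_scope.

(** The cost of a coupling [pi] is the norm in L^p(pi x pi) of a weighted l^q
    norm of three distortions d(f(x, x'), g(y, y')), one for each of psi (seen
    as a function of the first variable), omega and phi.  It is finite because
    the weighted norm is at most the sum of the distortions, and each
    distortion is in L^p as soon as f and g are.  The triangle inequality glues
    a coupling of X and Y to one of Y and Z ([gluing]) and applies Minkowski's
    inequality twice, for l^q ([weighted_normD]) and for L^p.  If X and Y are
    weakly isomorphic, the joint law of the two maps is a coupling of cost 0.

    The substance is the converse.  When the infimum is 0, take couplings pi_n
    of cost less than 1/(n+1).  As phi and omega are merely measurable, weak
    compactness of couplings is of little direct use; a setwise limit is taken
    instead, m(A, B) = lim pi_n(A x B) along an ultrafilter.  In each variable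
    m is finitely additive and dominated by a marginal, and this domination
    turns finite additivity into countable additivity ([dominated_additive]).
    Such an m is only a bimeasure, but on a Polish factor every bimeasure is
    realised by a probability on the product ([randomization]).  This yields a
    coupling pi ([limit_coupling]), and since the marginals control all tails
    uniformly, (pi_n x pi_n)(P x Q) tends to (pi x pi)(P x Q) along the
    ultrafilter for all measurable sets P of pairs in X and Q of pairs in Y,
    not only for rectangles ([cvg_dominated_additive]).  By separability, the
    set where f(x, x') differs from g(y, y') is a countable union of sets P x Q
    on which the distortion is bounded below ([separating_balls]); by
    Chebyshev's inequality their masses under pi_n x pi_n tend to 0, so pi x pi
    does not charge them ([distortion_ae0]).

    Randomization also replaces the disintegration of measures in [gluing].  It
    realises a bimeasure on Y x Z as the law of (y, T(y, u)) with u uniform on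
    [0, 1]: T is a conditional quantile function when Z is the real line, and
    in general Z is a measurable retract of the line.  For Polish Z the
    retraction comes from a code by countably many bits
    ([polish_bit_codable], [bit_codable_retract]); applied to X x Y, it also
    presents the limit coupling as an image of a law on the line, which is
    the Polish space W of the definition of weak isomorphism.

    The Fused Gromov-Wasserstein distance is the case where alpha = 0 and omega
    is constant ([forget_omega_surjective]). *)

(** * Image laws *)
Lemma preimage_measurable d d' (T : measurableType d) (U : measurableType d')
    (f : T -> U) A :
  measurable_fun [set: T] f -> measurable A -> measurable (f @^-1` A).
Proof. by move=> mf mA; rewrite -[X in measurable X]setTI; exact: mf. Qed.

Lemma measurable_ltr_set {R : realType} d (T : measurableType d)
    (f g : T -> R) : measurable_fun [set: T] f -> measurable_fun [set: T] g ->
  measurable [set x | f x < g x].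
Proof.
move=> mf mg; rewrite -[X in measurable X]setTI.
exact: (measurable_fun_ltr mf mg measurableT (Y := [set true]) I).
Qed.

Lemma measurable_ler_set {R : realType} d (T : measurableType d)
    (f g : T -> R) : measurable_fun [set: T] f -> measurable_fun [set: T] g ->
  measurable [set x | f x <= g x].
Proof.
move=> mf mg; rewrite -[X in measurable X]setTI.
exact: (measurable_fun_ler mf mg measurableT (Y := [set true]) I).
Qed.

Section ImageLaws.
Context {R : realType} d d' (T : measurableType d) (U : measurableType d').

Lemma image_law_exists (P : probability T R) (f : T -> U) :
  measurable_fun setT f -> exists nu : probability U R, image_law P f nu.
Proof.
move=> mf.
have PT : pushforward P f setT = 1%E.
  by rewrite /pushforward preimage_setT probability_setT.
pose M := Measure_isProbability.Build _ _ _ (pushforward P f) PT.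
pose Q : probability U R := HB.pack (pushforward P f) (M mf).
by exists (Q mf).
Qed.

End ImageLaws.

Section SquareMap.
Context {R : realType} d d' (T : measurableType d) (U : measurableType d').

Definition square_map (f : T -> U) (z : T * T) : U * U := (f z.1, f z.2).

Lemma measurable_square_map (f : T -> U) :
  measurable_fun setT f -> measurable_fun setT (square_map f).
Proof.
move=> mf; apply: measurable_fun_pair.
  exact: (measurableT_comp mf measurable_fst).
exact: (measurableT_comp mf measurable_snd).
Qed.

(** Both laws are probabilities that agree on rectangles. *)
Lemma image_law_square (P : probability T R) (f : T -> U)
    (Q : probability U R) : measurable_fun setT f -> image_law P f Q ->
  image_law (P \x P)%E (square_map f) (Q \x Q)%E.
Proof.
move=> mf PQ A mA; have mf2 := measurable_square_map mf.
pose PP : probability (T * T)%type R := (P \x P)%E.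
have [m mP] := image_law_exists PP mf2.
have mE : forall A B : set U, measurable A -> measurable B ->
    m (A `*` B) = (Q A * Q B)%E.
  move=> B C mB mC.
  have mpre D : measurable D -> measurable (f @^-1` D).
    exact: preimage_measurable.
  rewrite -mP; last exact: measurableX.
  rewrite -(PQ _ mB) -(PQ _ mC) /pushforward.
  rewrite -(product_measure1E P P (mpre _ mB) (mpre _ mC)).
  by [].
transitivity (m A); first exact: mP.
by symmetry; exact: (product_measure_unique mE mA).
Qed.

End SquareMap.

Section LnormImageLaw.
Context {R : realType} d d' (T : measurableType d) (U : measurableType d').

(** Change of variables for every exponent at least 1, including the
    essential supremum. *)
Lemma Lnorm_image_law (P : probability T R) (f : T -> U)
    (Q : probability U R) (p : \bar R) (g : U -> \bar R) :
  measurable_fun setT f -> image_law P f Q -> measurable_fun [set: U] g ->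
  (1 <= p)%E -> 'N[Q]_p[g]%E = 'N[P]_p[g \o f]%E.
Proof.
move=> mf PQ mg; case: p => [r||//] _; rewrite unlock.
- congr (_ `^ _)%E.
  rewrite (@eq_measure_integral _ _ _ _ (pushforward P f)).
  + rewrite ge0_integral_pushforward//.
      apply: (@measurableT_comp _ _ _ _ _ _ (fun x : \bar R => x `^ r)%E) => //.
      exact: measurable_poweR.
      exact: measurableT_comp.
    by move=> y _; exact: poweR_ge0.
  + by move=> A mA _; apply/esym/PQ.
- have QT : (0 < Q setT)%E by rewrite probability_setT lte01.
  have PT : (0 < P setT)%E by rewrite probability_setT lte01.
  rewrite !ifT// !ess_supEmu0; last 2 first.
  + by apply: measurableT_comp => //; exact: measurableT_comp.
  + exact: measurableT_comp.
  have mag : measurable_fun [set: U] (abse \o g) by exact: measurableT_comp.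
  have mpre y : measurable ((abse \o g) @^-1` `]y, +oo[%classic).
    by apply: (preimage_measurable mag); exact: emeasurable_itv.
  by congr ereal_inf; apply/seteqP; split => y /=; rewrite -PQ.
Qed.

End LnormImageLaw.

(** * Finitely additive functions dominated by a probability *)
Section DominatedAdditive.
Context {R : realType} d (T : measurableType d).
Implicit Types (nu : probability T R) (a : set T -> R).

(** Only finite additivity is asked, so that the notion passes to pointwise
    limits ([dominated_additive_cvg]); countable additivity follows from the
    bound by [nu], because [nu] is continuous from above.  Working with plain
    real-valued set functions makes the sections of a bimeasure instances of
    it. *)
Definition dominated_additive nu a :=
  (forall A, measurable A -> 0 <= a A /\ ((a A)%:E <= nu A)%E) /\
  (forall A B, measurable A -> measurable B -> A `&` B = set0 ->
    a (A `|` B) = a A + a B).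

Lemma dominated_additive0 nu a : dominated_additive nu a -> a set0 = 0.
Proof.
move=> [_ aU]; have := aU _ _ (@measurable0 _ T) (@measurable0 _ T) (setI0 _).
by rewrite setU0 => /eqP; rewrite -subr_eq subrr => /eqP.
Qed.

Lemma dominated_additiveC nu a A : dominated_additive nu a -> measurable A ->
  a (~` A) = a setT - a A.
Proof.
move=> [_ aU] mA; rewrite -(setvU A) aU//; first by rewrite addrK.
  exact: measurableC.
by rewrite setICl.
Qed.

Lemma dominated_additiveD nu a A B : dominated_additive nu a ->
  measurable A -> measurable B -> A `<=` B -> a (B `\` A) = a B - a A.
Proof.
move=> [_ aU] mA mB AB; rewrite -[in RHS](setDUK AB) aU//.
- by rewrite addrAC subrr add0r.
- exact: measurableD.
- by rewrite setDIK.
Qed.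

Lemma dominated_additive_le nu a A B : dominated_additive nu a ->
  measurable A -> measurable B -> A `<=` B -> a A <= a B.
Proof.
move=> da mA mB AB; rewrite -subr_ge0 -(dominated_additiveD da)//.
by apply da.1; exact: measurableD.
Qed.

Lemma dominated_additive_bigsetU nu a (F : (set T)^nat) n :
  dominated_additive nu a -> (forall k, measurable (F k)) ->
  trivIset setT F ->
  a (\big[setU/set0]_(k < n) F k) = \sum_(k < n) a (F k).
Proof.
move=> da mF tF; elim: n => [|n IH].
  by rewrite !big_ord0 (dominated_additive0 da).
rewrite !big_ord_recr/= da.2 ?IH//; first exact: bigsetU_measurable.
by apply: (@trivIset_bigsetUI _ predT) => //; exact: sub_trivIset tF.
Qed.

(** The defect of countable additivity after [n] terms is the mass of the tail,
    which [nu] bounds independently of [a]: this uniformity is what allows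
    limits and countable unions to be exchanged. *)
Lemma dominated_additive_bigcup nu a (F : (set T)^nat) n :
  dominated_additive nu a -> (forall k, measurable (F k)) ->
  trivIset setT F ->
  0 <= a (\bigcup_k F k) - \sum_(k < n) a (F k) <=
    fine (nu (\bigcup_k F k `\` \big[setU/set0]_(k < n) F k)).
Proof.
move=> da mF tF; set tail := (X in nu X).
have mU : measurable (\bigcup_k F k) by exact: bigcupT_measurable.
have mUn : measurable (\big[setU/set0]_(k < n) F k).
  exact: bigsetU_measurable.
rewrite -(dominated_additive_bigsetU n da)// -(dominated_additiveD da)//.
  have mtail : measurable tail by exact: measurableD.
  have [-> h] := da.1 _ mtail; rewrite -lee_fin fineK//.
  exact: fin_num_measure.
by rewrite -bigcup_mkord; apply: bigcup_sub => i _; exact: bigcup_sup.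
Qed.

Lemma cvg_setD_nondecreasing nu (F : (set T)^nat) :
  (forall k, measurable (F k)) -> nondecreasing_seq F ->
  forall e, 0 < e -> \forall n \near \oo, fine (nu (\bigcup_k F k `\` F n)) < e.
Proof.
move=> mF ndF e e0; have mU : measurable (\bigcup_k F k).
  exact: bigcupT_measurable.
pose G n := \bigcup_k F k `\` F n.
have mG n : measurable (G n) by exact: measurableD.
have G0 : \bigcap_n G n = set0.
  apply/seteqP; split => // x h.
  have [[k _ Fkx] _] := h 0%N I.
  by have [_] := h k I; apply.
have /fine_cvg : (nu \o G) n @[n --> \oo] --> (fine (nu (\bigcap_n G n)))%:E.
  rewrite fineK ?fin_num_measure ?G0//; rewrite -G0;
    apply: nonincreasing_cvg_mu => //.
  - by rewrite ltey_eq fin_num_measure.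
  - by rewrite G0.
  - by move=> m n mn; apply/subsetPset; apply: setDS; apply/subsetPset;
    exact: ndF.
rewrite G0 measure0 => /cvgr0Pnorm_lt /(_ _ e0); apply: filterS => n hn.
exact: le_lt_trans (ler_norm _) hn.
Qed.

Lemma cvg_tail nu (F : (set T)^nat) : (forall k, measurable (F k)) ->
  forall e, 0 < e -> \forall n \near \oo,
  fine (nu (\bigcup_k F k `\` \big[setU/set0]_(k < n) F k)) < e.
Proof.
move=> mF e e0; rewrite (_ : \bigcup_k F k =
    \bigcup_n \big[setU/set0]_(k < n) F k); last first.
  apply/seteqP; split => [x [k _ Fkx]|].
    by exists k.+1 => //; rewrite -bigcup_mkord; exists k => /=.
  apply: bigcup_sub => n _; rewrite -bigcup_mkord.
  by apply: bigcup_sub => i _; exact: bigcup_sup.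
apply: cvg_setD_nondecreasing => // [n|m n mn]; first exact: bigsetU_measurable.
by apply/subsetPset/subset_bigsetU.
Qed.

Lemma dominated_additive_cvg_nondecreasing nu a (F : (set T)^nat) :
  dominated_additive nu a -> (forall k, measurable (F k)) ->
  nondecreasing_seq F -> a (F n) @[n --> \oo] --> a (\bigcup_k F k).
Proof.
move=> da mF ndF; apply/cvgrPdist_lt => e e0.
have mU : measurable (\bigcup_k F k) by exact: bigcupT_measurable.
apply: filterS (cvg_setD_nondecreasing nu mF ndF e0) => n hn.
rewrite -(dominated_additiveD da)//; last exact: bigcup_sup.
have mD : measurable (\bigcup_k F k `\` F n) by exact: measurableD.
have [h1 h2] := da.1 _ mD; rewrite ger0_norm//; apply: le_lt_trans hn.
by rewrite -lee_fin fineK// fin_num_measure.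
Qed.

(** Dynkin's argument for convergence: the sets on which [a_ i] tends to [a]
    are stable under disjoint countable unions, because the tails of [a_ i] are
    bounded by those of [nu] uniformly in [i].  The filter is arbitrary because
    it will be an ultrafilter. *)
Lemma cvg_dominated_additive nu nu' (I : Type) (F : set_system I)
    {FF : ProperFilter F} (G : set (set T)) (a_ : I -> set T -> R)
    (a : set T -> R) :
  measurable = <<s G >> -> setI_closed G ->
  (forall i, dominated_additive nu (a_ i)) -> dominated_additive nu' a ->
  a_ i setT @[i --> F] --> a setT ->
  (forall A, G A -> a_ i A @[i --> F] --> a A) ->
  forall A, measurable A -> a_ i A @[i --> F] --> a A.
Proof.
move=> mG GI da_ da aT aG A mA.
have {mA} : <<s G >> A by rewrite -mG.
move: A; apply: (dynkin_induction mG GI aT aG).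
- move=> S mS aS; rewrite (dominated_additiveC da mS).
  under eq_fun do rewrite (dominated_additiveC (da_ _) mS).
  exact: cvgB.
- move=> H mH tH aH; apply/cvgrPdist_lt => e e0.
  have e2 : 0 < e / 2 by rewrite divr_gt0.
  have [n _ /(_ _ (leqnn _)) [hn hn']] :=
    filterI (cvg_tail nu mH e2) (cvg_tail nu' mH e2).
  have : \sum_(k < n) a_ i (H k) @[i --> F] --> \sum_(k < n) a (H k).
    by apply: cvg_big => [|k _]; [exact: add_continuous|exact: aH].
  move/cvgrPdist_lt => /(_ _ e2); apply: filterS => i hi.
  have /andP[h1 h2] := dominated_additive_bigcup n da mH tH.
  have /andP[h3 h4] := dominated_additive_bigcup n (da_ i) mH tH.
  move: hi h1 h2 h3 h4 hn hn'; rewrite /= !ltr_distl.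
  set u := a _; set v := a_ _ _; set s := \sum_(_ < _) _.
  set t := \sum_(_ < _) _; set w := fine (nu _); set w' := fine _.
  by lra.
Qed.

(** Convergence of a constant sequence. *)
Lemma dominated_additive_unique nu nu' (G : set (set T)) (a b : set T -> R) :
  measurable = <<s G >> -> setI_closed G ->
  dominated_additive nu a -> dominated_additive nu' b ->
  a setT = b setT -> (forall A, G A -> a A = b A) ->
  forall A, measurable A -> a A = b A.
Proof.
move=> mG GI da db abT abG A mA.
have cab B : a B = b B -> (fun=> a B) n @[n --> \oo] --> b B.
  by move=> ->; exact: cvg_cst.
have h := @cvg_dominated_additive nu nu' nat \oo (eventually_filter) G (fun=> a)
  b mG GI
  (fun=> da) db (cab _ abT) (fun B GB => cab _ (abG B GB)) A mA.
by rewrite -(cvg_lim (@Rhausdorff R) h) lim_cst.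
Qed.

Lemma probability_dominated_additive (P : probability T R) :
  dominated_additive P (fun A => fine (P A)).
Proof.
split => [A mA|A B mA mB AB0].
  by split; [exact: fine_ge0|rewrite fineK// fin_num_measure].
by rewrite measureU// fineD// fin_num_measure.
Qed.

Lemma dominated_additive_cvg nu (I : Type) (F : set_system I)
    {FF : ProperFilter F} (a_ : I -> set T -> R) (a : set T -> R) :
  (forall i, dominated_additive nu (a_ i)) ->
  (forall A, measurable A -> a_ i A @[i --> F] --> a A) ->
  dominated_additive nu a.
Proof.
move=> da_ ca; split => [A mA|A B mA mB AB0].
  have cA := ca A mA; split.
    by apply: (cvgr_to_ge cA); apply: nearW => i; exact: ((da_ i).1 _ mA).1.
  rewrite -[X in (_ <= X)%E]fineK ?fin_num_measure// lee_fin.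
  apply: (cvgr_to_le cA); apply: nearW => i.
  rewrite -lee_fin fineK ?fin_num_measure//; exact: ((da_ i).1 _ mA).2.
have /(cvg_lim (@Rhausdorff R)) <- := ca _ (measurableU _ _ mA mB).
apply: cvg_lim => //; under eq_fun do rewrite (da_ _).2//.
by apply: cvgD; exact: ca.
Qed.

(** A dominated additive function is a finite measure absolutely continuous
    with respect to [nu], whence a Radon-Nikodym derivative. *)
Lemma dominated_additive_density nu a : dominated_additive nu a ->
  exists f : T -> R, [/\ measurable_fun [set: T] f, forall x, 0 <= f x,
    nu.-integrable setT (EFin \o f) &
    forall A, measurable A -> (\int[nu]_(x in A) (f x)%:E = (a A)%:E)%E].
Proof.
move=> da.
(* a measure must be nonnegative on all sets, a is so on measurable sets only *)
pose m A : \bar R := `|a A|%:E.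
have mE A : measurable A -> m A = (a A)%:E.
  by move=> mA; rewrite /m ger0_norm//; exact: (da.1 _ mA).1.
have m0 : m set0 = 0%E by rewrite /m (dominated_additive0 da) normr0.
have m_ge0 A : (0 <= m A)%E by rewrite lee_fin.
have msa : semi_sigma_additive m.
  move=> F mF tF mUF; rewrite mE//.
  have -> : (fun n => \sum_(0 <= i < n) m (F i))%E =
      EFin \o (fun n => \sum_(i < n) a (F i)).
    apply/funext => n /=; rewrite -sumEFin big_mkord.
    by apply: eq_bigr => i _; rewrite mE.
  apply: cvg_EFin; first exact: nearW.
  apply/cvgrPdist_lt => e e0; have := cvg_tail nu mF e0.
  apply: filterS => n hn /=.
  have /andP[h1 h2] := dominated_additive_bigcup n da mF tF.
  by rewrite ger0_norm//; exact: le_lt_trans hn.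
have m_fin : fin_num_fun m by [].
pose M1 := isMeasure.Build _ _ _ m m0 m_ge0 msa.
pose m1 : {measure set T -> \bar R} := HB.pack m M1.
pose M2 := Measure_isFinite.Build _ _ _ m1 m_fin.
pose m2 : {finite_measure set T -> \bar R} := HB.pack m M1 M2.
have m_nu : m2 `<< nu.
  apply/null_content_dominatesP => A mA nuA0.
  have [h1 h2] := da.1 _ mA; apply/eqP; rewrite eq_le measure_ge0 andbT.
  by rewrite -nuA0; apply: le_trans h2; rewrite /= mE.
exists (fine \o Radon_Nikodym_SigmaFinite.f m2 nu).
have fi := Radon_Nikodym_SigmaFinite.f_integrable m_nu.
have fE x : (fine (Radon_Nikodym_SigmaFinite.f m2 nu x))%:E =
    Radon_Nikodym_SigmaFinite.f m2 nu x.
  by rewrite fineK//; exact: Radon_Nikodym_SigmaFinite.f_fin_num.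
split.
- apply/measurable_EFinP; apply: eq_measurable_fun (measurable_int _ fi).
  by move=> x _ /=; rewrite fE.
- by move=> x /=; apply: fine_ge0; exact: Radon_Nikodym_SigmaFinite.f_ge0.
- by apply: eq_integrable fi => // x _ /=; rewrite fE.
- move=> A mA; rewrite -mE// -[RHS](_ : m2 A = _)//.
  rewrite (Radon_Nikodym_SigmaFinite.f_integral m_nu)//.
  by apply: eq_integral => x _ /=; rewrite fE.
Qed.

Lemma density_le nu (f g : T -> R) :
  nu.-integrable setT (EFin \o f) -> nu.-integrable setT (EFin \o g) ->
  (forall A, measurable A ->
    \int[nu]_(x in A) (f x)%:E <= \int[nu]_(x in A) (g x)%:E)%E ->
  \forall x \ae nu, f x <= g x.
Proof.
move=> fi gi fg.
have mf : measurable_fun [set: T] f.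
  by apply/measurable_EFinP; case/integrableP: fi.
have mg : measurable_fun [set: T] g.
  by apply/measurable_EFinP; case/integrableP: gi.
pose A := [set x | g x < f x].
have mA : measurable A by exact: measurable_ltr_set.
have : ae_eq nu A (EFin \o f) (EFin \o g).
  apply: integral_ae_eq => //.
  - exact: integrableS fi.
  - by apply: measurable_funTS; apply/measurable_EFinP.
  - move=> E EA mE; apply/eqP; rewrite eq_le fg//=.
    apply: le_integral => //; [exact: integrableS gi|exact: integrableS fi|].
    by move=> x; rewrite inE => /EA /ltW; rewrite lee_fin.
apply: filterS => x /= h; rewrite leNgt; apply/negP => xA.
by have [fgx] := h xA; move: xA; rewrite fgx ltxx.
Qed.

End DominatedAdditive.

Lemma ae_forall_countable {R : realType} d (T : measurableType d)
    (mu : probability T R) (I : countType) (P : I -> T -> Prop) :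
  (forall i, \forall x \ae mu, P i x) -> \forall x \ae mu, forall i, P i x.
Proof.
move=> aeP; have : \forall x \ae mu, forall n,
    if unpickle n is Some i then P i x else True.
  apply/ae_foralln => n; case: unpickle => [i|]; last exact: nearW.
  exact: aeP.
by apply: filterS => x Px i; have := Px (pickle i); rewrite pickleK.
Qed.

(** Compactness of a segment gives a cluster point, and an ultrafilter
    converges to each of its cluster points. *)
Lemma ultrafilter_cvg (R : realType) (U : set_system nat) (u : nat -> R)
    (a b : R) :
  UltraFilter U -> (forall n, a <= u n <= b) ->
  exists l : R, u n @[n --> U] --> l.
Proof.
move=> UU uab.
have : (u @ U) `[a, b]%classic by apply: nearW => n /=; rewrite in_itv/= uab.
move=> /segment_compact [l [_]].
exists l; apply/cvgrPdist_lt => e e0.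
have [//|nUe] := in_ultra_setVsetC [set n | `|l - u n| < e] UU.
have : cluster (u @ U) l by [].
move=> /(_ (u @` (~` [set n | `|l - u n| < e])) (ball l e)).
case.
- by apply: (@filterS _ U _ _ _ _ nUe) => n hn; exists n.
- exact: nbhsx_ballx.
- by move=> _ [[n hn <-]]; rewrite /ball/= => /hn.
Qed.

(** * Laws on products *)
Section Rectangles.
Context {R : realType} d d' (T : measurableType d) (U : measurableType d').

Definition rectangles : set (set (T * U)) :=
  [set A `*` B | A in measurable & B in measurable].

Lemma rectangles_setI_closed : setI_closed rectangles.
Proof.
move=> _ _ [A mA [B mB <-]] [A' mA' [B' mB' <-]].
exists (A `&` A'); first exact: measurableI.
by exists (B `&` B'); [exact: measurableI|rewrite setXI].
Qed.

Lemma probability_rectangles_unique (P Q : probability (T * U)%type R) :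
  (forall A B, measurable A -> measurable B -> P (A `*` B) = Q (A `*` B)) ->
  forall C, measurable C -> P C = Q C.
Proof.
move=> PQ C mC.
rewrite -[LHS]fineK ?fin_num_measure// -[RHS]fineK ?fin_num_measure//.
congr _%:E.
apply: (dominated_additive_unique (measurable_prod_measurableType T U)
  rectangles_setI_closed (probability_dominated_additive P)
  (probability_dominated_additive Q)) => //.
  by rewrite !probability_setT.
by move=> _ [A mA [B mB <-]]; rewrite PQ.
Qed.

Lemma product_probability_fst (P : probability T R) (Q : probability U R) A :
  measurable A -> (P \x Q)%E [set w | A w.1] = P A.
Proof.
move=> mA; rewrite (_ : mkset _ = A `*` setT).
  by rewrite -[RHS]mule1 -(probability_setT Q); exact: product_measure1E.
by apply/seteqP; split => w //= -[].
Qed.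

End Rectangles.

Section Composition.
Context {R : realType} d1 d2 d3 (T : measurableType d1) (U : measurableType d2)
  (V : measurableType d3).

Lemma image_law_comp (P : probability T R) (Q : probability U R)
    (S : probability V R) (f : T -> U) (g : U -> V) :
  measurable_fun [set: U] g -> image_law P f Q -> image_law Q g S ->
  image_law P (g \o f) S.
Proof.
move=> mg PQ QS A mA; rewrite -QS// /pushforward -PQ//.
exact: (preimage_measurable mg).
Qed.

(** Used to read off the marginals of the joint law of several maps. *)
Lemma image_law_factor (P : probability T R) (Q : probability U R)
    (S : probability V R) (f : T -> U) (g : U -> V) :
  measurable_fun [set: U] g -> image_law P f Q -> image_law P (g \o f) S ->
  image_law Q g S.
Proof.
move=> mg PQ PS A mA; rewrite -PS// /pushforward -PQ//.
exact: (preimage_measurable mg).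
Qed.

End Composition.

Section DominatedAdditiveLaws.
Context {R : realType} d d' (T : measurableType d) (U : measurableType d').

Lemma dominated_additive_restrict (P : probability T R) E : measurable E ->
  dominated_additive P (fun A => fine (P (E `&` A))).
Proof.
move=> mE; have fin A : measurable A -> P (E `&` A) \is a fin_num.
  by move=> mA; apply: fin_num_measure; exact: measurableI.
split => [A mA|A B mA mB AB0].
  split; first exact: fine_ge0.
  rewrite fineK ?fin//; apply: le_measure; rewrite ?inE//.
  exact: measurableI.
rewrite setIUr measureU; [|exact: measurableI|exact: measurableI|].
  by rewrite fineD// fin.
by rewrite setIACA setIid AB0 setI0.
Qed.

Lemma dominated_additive_pullback (P : probability T R) (Q : probability U R)
    (f : T -> U) (a : set T -> R) :
  measurable_fun [set: T] f -> image_law P f Q -> dominated_additive P a ->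
  dominated_additive Q (fun A => a (f @^-1` A)).
Proof.
move=> mf PQ da; split => [A mA|A B mA mB AB0].
  by have [? ?] := da.1 _ (preimage_measurable mf mA); rewrite -PQ.
rewrite preimage_setU; apply: da.2.
- exact: (preimage_measurable mf mA).
- exact: (preimage_measurable mf mB).
- by rewrite -preimage_setI AB0 preimage_set0.
Qed.

(** One variable of a bimeasure at a time: when [T] is a product and [f] one of
    its projections, the mass of a rectangle is dominated additive with respect
    to the marginal. *)
Lemma image_law_dominated (P : probability T R) (f : T -> U)
    (Q : probability U R) E : measurable_fun [set: T] f -> image_law P f Q ->
  measurable E -> dominated_additive Q (fun A => fine (P (E `&` f @^-1` A))).
Proof.
move=> mf PQ mE.
exact: (dominated_additive_pullback mf PQ (dominated_additive_restrict P mE)).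
Qed.

End DominatedAdditiveLaws.

(** * Coding by bits *)
Section BitCoding.
Context {R : realType}.

(** A point is determined by the countably many bits [B n x], and the decoder
    [J] preserves measurability in a parameter.  The last clause speaks of
    arbitrary families of bits, codes of points or not; it replaces a
    sigma-algebra on the sequences of bits. *)
Definition bit_codable d (T : measurableType d) : Prop :=
  exists (B : nat -> set T) (J : (nat -> bool) -> T),
  [/\ forall n, measurable (B n), forall x, J (fun n => `[< B n x >]) = x &
    forall d' (S : measurableType d') (b : nat -> S -> bool),
      (forall n, measurable [set s | b n s]) ->
      measurable_fun [set: S] (fun s => J (b ^~ s))].

(** The even bits code the first component and the odd bits the second. *)
Lemma bit_codable_prod d d' (T : measurableType d) (U : measurableType d') :
  bit_codable T -> bit_codable U -> bit_codable (T * U)%type.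
Proof.
move=> [B [J [mB BJ mJ]]] [B' [J' [mB' BJ' mJ']]].
exists (fun n => if odd n then setT `*` B' n./2 else B n./2 `*` setT).
exists (fun b => (J (fun n => b n.*2), J' (fun n => b n.*2.+1))); split.
- by move=> n; case: ifP => _; exact: measurableX.
- move=> [x y]; congr (_, _).
  + rewrite -[RHS]BJ; congr J; apply/funext => n.
    rewrite odd_double doubleK; apply: asbool_equiv_eq.
    by split => [[]|].
  + rewrite -[RHS]BJ'; congr J'; apply/funext => n.
    rewrite /= odd_double uphalf_double; apply: asbool_equiv_eq.
    by split => [[]|].
- move=> d'' S b mb; apply: measurable_fun_pair.
  + by apply: (mJ _ _ (fun n => b n.*2)).
  + by apply: (mJ' _ _ (fun n => b n.*2.+1)).
Qed.

Let term (b : nat -> bool) (n : nat) : R := (b n)%:R * 3^-1 ^+ n.+1.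

(** The sum of the [b n / 3 ^ n.+1].  In base 3 with digits 0 and 1 the tail of
    the expansion is at most 1/2, so that the first digit is 1 exactly when the
    value is at least 1/3; in base 2 the digits would be ambiguous. *)
Definition ternary (b : nat -> bool) : R := lim (series (term b) @ \oo).

Let term_ge0 b n : 0 <= term b n.
Proof. by rewrite mulr_ge0// exprn_ge0// invr_ge0. Qed.

Let series_shift b n :
  series (term b) n.+1 = (b 0%N)%:R / 3 + series (term (b \o S)) n / 3.
Proof.
rewrite /series/= big_nat_recl//=; congr (_ + _).
by rewrite mulr_suml; apply: eq_bigr => i _; rewrite /term/= exprSr mulrA.
Qed.

Let series_le b n : series (term b) n <= 2^-1.
Proof.
elim: n b => [|n IH] b; first by rewrite /series/= big_geq.
rewrite series_shift; have := IH (b \o S).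
by case: (b 0%N) => /= h; lra.
Qed.

Let cvg_ternary b : series (term b) n @[n --> \oo] --> ternary b.
Proof.
apply: nondecreasing_is_cvgn.
  by apply: nondecreasing_series => n _ _; exact: term_ge0.
by exists 2^-1 => _ [n _ <-]; exact: series_le.
Qed.

Let ternary_shift b : ternary b = (b 0%N)%:R / 3 + ternary (b \o S) / 3.
Proof.
have h1 : series (term b) n.+1 @[n --> \oo] --> ternary b.
  by rewrite (cvg_shiftS (series (term b))).
rewrite -(cvg_lim (@Rhausdorff R) h1); apply: cvg_lim => //.
under eq_fun do rewrite series_shift.
apply: cvgD; first exact: cvg_cst.
by apply: cvgMl; exact: cvg_ternary.
Qed.

Let ternary_ge0 b : 0 <= ternary b.
Proof.
apply: (cvgr_to_ge (@cvg_ternary b)); apply: nearW => n.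
by apply: sumr_ge0 => i _; exact: term_ge0.
Qed.

Let ternary_le b : ternary b <= 2^-1.
Proof.
by apply: (cvgr_to_le (@cvg_ternary b)); apply: nearW => n; exact: series_le.
Qed.

(** Multiplication by 3 followed by the removal of the first digit. *)
Definition ternary_step (y : R) : R := 3 * y - (3^-1 <= y)%R%:R.

Definition ternary_digit n (y : R) : bool := 3^-1 <= iter n ternary_step y.

Lemma ternary_digitK b n : ternary_digit n (ternary b) = b n.
Proof.
have h0 c : (3^-1 <= ternary c) = c 0%N.
  have := ternary_ge0 (c \o S); have := ternary_le (c \o S).
  rewrite (ternary_shift c); case: (c 0%N) => /= h1 h2.
    by apply/idP; lra.
  by apply/negbTE; rewrite -ltNge; lra.
have hS c : ternary_step (ternary c) = ternary (c \o S).
  rewrite /ternary_step h0 (ternary_shift c); lra.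
rewrite /ternary_digit.
have -> : iter n ternary_step (ternary b) = ternary (fun k => b (n + k)%N).
  elim: n => [|n IH] //=; rewrite IH hS; congr ternary.
  by apply/funext => k /=; rewrite addnS.
by rewrite h0 addn0.
Qed.

Lemma measurable_ternary d (S : measurableType d) (b : nat -> S -> bool) :
  (forall n, measurable [set s | b n s]) ->
  measurable_fun [set: S] (fun s => ternary (b ^~ s)).
Proof.
move=> mb; apply: (measurable_fun_cvg
  (h := fun n s => series (term (b ^~ s)) n)).
- move=> n; apply: measurable_sum => i; apply: measurable_funM => //.
  rewrite (_ : (fun s => _) = \1_[set s | b i s]).
    exact: measurable_indic.
  by apply/funext => s; rewrite indicE mem_setE.
- by move=> s _; exact: cvg_ternary.
Qed.

Lemma measurable_ternary_digit n : measurable [set y | ternary_digit n y].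
Proof.
have ms : measurable_fun [set: R] ternary_step.
  apply: measurable_funB => //.
  rewrite (_ : (fun s => _) = \1_[set s | 3^-1 <= s]).
    by apply: measurable_indic; exact: measurable_ler_set.
  by apply/funext => s; rewrite indicE mem_setE.
have mi : measurable_fun [set: R] (iter n ternary_step).
  by elim: n => [|n IH]; [exact: measurable_id|exact: measurableT_comp].
exact: (measurable_ler_set (measurable_cst (3^-1 : R)) mi).
Qed.

(** The bits of a point are stored as the digits of a real number. *)
Lemma bit_codable_retract d (T : measurableType d) : bit_codable T ->
  exists (i : T -> R) (j : R -> T),
    [/\ measurable_fun setT i, measurable_fun setT j & cancel i j].
Proof.
move=> [B [J [mB BJ mJ]]].
exists (fun x => ternary (fun n => `[< B n x >])).
exists (fun y => J (ternary_digit ^~ y)); split.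
- apply: (measurable_ternary (b := fun n x => `[< B n x >])) => n.
  rewrite [X in measurable X](_ : _ = B n)//.
  by apply/seteqP; split => x /asboolP.
- by apply: (mJ _ _ ternary_digit); exact: measurable_ternary_digit.
- move=> x; rewrite -[RHS]BJ; congr J; apply/funext => n.
  exact: ternary_digitK.
Qed.

End BitCoding.

(** * Polish spaces are codable by bits *)
Lemma measurable_to_borel d (S : measurableType d) (X : ptopologicalType)
    (f : S -> X) : (forall V, open V -> measurable (f @^-1` V)) ->
  measurable_fun [set: S] (f : S -> borel X).
Proof.
move=> fopen _ A mA; rewrite setTI; move: A mA; apply: smallest_sub => //.
split => [|A mA|A mA].
- by rewrite /= preimage_set0; exact: measurable0.
- by rewrite /= setTD preimage_setC; exact: measurableC.
- by rewrite /= preimage_bigcup; exact: bigcupT_measurable.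
Qed.

Lemma separable_dense_sequence (T : topologicalType) (t0 : T) :
  separable_space T ->
  exists t_ : nat -> T, forall O, open O -> O !=set0 -> exists n, O (t_ n).
Proof.
move=> [D /countable_injP[f finj] denseD].
exists (fun n => xget t0 [set y | D y /\ f y = n]) => V oV V0.
have [y [Vy Dy]] := denseD V V0 oV; exists (f y).
case: xgetP => [z _ [Dz fz]|/(_ y)/not_andP[]//].
by rewrite (finj z y) ?inE.
Qed.

(** Let [x_] be a dense sequence and [r n = 1 / n.+1].  The bits of [x] tell to
    which balls B(x_ k, r n) it belongs.  To decode, take for every n the first
    center k whose bit is set: the points so selected form a Cauchy sequence
    with limit [x].  For an arbitrary sequence of bits this can fail in two
    ways, a radius without center or two incompatible balls; both are countable
    conditions on the bits, hence measurable, and the decoder then returns a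
    default point. *)
Section PolishBitCodable.
Context {R : realType} (X : ptopologicalType) (M : metricType R).
Context (h : X -> M) (g : M -> X).
Hypotheses (hK : cancel h g) (ch : continuous h) (cg : continuous g).
Hypothesis completeM : forall F : set_system M, ProperFilter F -> cauchy F ->
  exists x : M, F --> x.
Hypothesis separableX : separable_space X.

(** The complete metric carried back to [X] by the homeomorphism [h]. *)
Let dist x y := mdist (h x) (h y).

Let distxx x : dist x x = 0. Proof. exact: mdistxx. Qed.

Let dist_sym x y : dist x y = dist y x. Proof. exact: metric_sym. Qed.

Let dist_triangle x y z : dist x z <= dist x y + dist y z.
Proof. exact: metric_triangle. Qed.

Let dist_eq x y : (forall e, 0 < e -> dist x y <= e) -> x = y.
Proof.
move=> xy; rewrite -(hK x) -(hK y); congr g; apply: mdist_positivity.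
apply/eqP; rewrite eq_le mdist_ge0 andbT; apply/ler_addgt0Pl => e e0.
by rewrite addr0; exact: xy.
Qed.

Let open_dball x e : open [set y | dist x y < e].
Proof.
rewrite openE => y /= xy; rewrite /interior.
have e0 : 0 < e - dist x y by rewrite subr_gt0.
have : nbhs y (h @^-1` ball (h y) (e - dist x y)).
  by apply: ch; exact: nbhsx_ballx.
apply: filterS => z; rewrite ballEmdist/= => yz.
by rewrite (le_lt_trans (dist_triangle x y z))// -ltrBDl.
Qed.

Let dball_open (O : set X) x : open O -> O x ->
  exists2 e, 0 < e & forall y, dist x y < e -> O y.
Proof.
move=> oO Ox.
have /cg : nbhs (g (h x)) O by rewrite hK; exact: open_nbhs_nbhs.
move=> /nbhs_ballP[e /= e0 eO]; exists e => // y xy.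
by rewrite -(hK y); apply: eO; rewrite ballEmdist.
Qed.

Let complete_dist (u : nat -> X) :
  (forall e, 0 < e -> exists N, forall m n, (N <= m)%N -> (N <= n)%N ->
    dist (u m) (u n) < e) ->
  exists x, forall e, 0 < e -> exists N, forall n, (N <= n)%N ->
    dist (u n) x < e.
Proof.
move=> cu.
have [|x Fx] := completeM (F := (h \o u) @ \oo).
  apply: cauchy_exP => e e0; have [N uN] := cu _ e0.
  exists (h (u N)); exists N => // n /= Nn.
  by rewrite ballEmdist/=; exact: uN.
exists (g x) => e e0.
have : nbhs (g x) [set y | dist (g x) y < e].
  apply: open_nbhs_nbhs; split; first exact: open_dball.
  by rewrite /mkset distxx.
move=> /cg /Fx [N _ hN]; exists N => n Nn.
by rewrite dist_sym -[X in dist _ X]hK; exact: (hN _ Nn).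
Qed.

Let seqD : exists x_ : nat -> X,
  forall x e, 0 < e -> exists n, dist (x_ n) x < e.
Proof.
have [t_ ht] := separable_dense_sequence (point : X) separableX.
exists t_ => x e e0; have [||n xn] := ht [set y | dist x y < e].
- exact: open_dball.
- by exists x; rewrite /mkset distxx.
- by exists n; rewrite dist_sym.
Qed.

Let x_ := sval (cid seqD).
Let x_dense : forall x e, 0 < e -> exists n, dist (x_ n) x < e.
Proof. by rewrite /x_; case: cid. Qed.

Let r n : R := n.+1%:R^-1.
Let r_gt0 n : 0 < r n. Proof. by rewrite invr_gt0. Qed.
Let r_lt e : 0 < e -> exists N, forall n, (N <= n)%N -> r n < e.
Proof.
by move=> e0; have [N _ hN] := near_infty_natSinv_lt (PosNum e0); exists N.
Qed.

Let bit (b : nat -> bool) (n k : nat) := b (pickle (n, k)).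
Let first (b : nat -> bool) (n k : nat) :=
  bit b n k /\ forall l, (l < k)%N -> ~~ bit b n l.

Let first_uniq b n k l : first b n k -> first b n l -> k = l.
Proof.
move=> [bk hk] [bl hl]; case: (ltngtP k l) => // kl.
- by have := hl _ kl; rewrite bk.
- by have := hk _ kl; rewrite bl.
Qed.

Let first_ex b n : (exists k, bit b n k) -> exists k, first b n k.
Proof.
move=> exk; case: (ex_minnP exk) => k bk hk; exists k; split => // l lk.
by apply/negP => /hk; rewrite leqNgt lk.
Qed.

Let total (b : nat -> bool) := forall n, exists k, first b n k.
(** Two balls that share a point have centers at distance at most the sum of
    the radii; this weaker condition involves no point of the space. *)
Let compatible (b : nat -> bool) := ~ exists n m k l,
  [/\ r n + r m < dist (x_ k) (x_ l), first b n k & first b m l].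

Let limit (b : nat -> bool) (x : X) :=
  forall n k, first b n k -> dist (x_ k) x <= r n.

Let limit_ex b : total b -> compatible b -> exists x, limit b x.
Proof.
move=> tb cb; pose kk n := sval (cid (tb n)).
have hkk n : first b n (kk n) by rewrite /kk; case: cid.
have dkk n m : dist (x_ (kk n)) (x_ (kk m)) <= r n + r m.
  rewrite leNgt; apply/negP => lt; apply: cb.
  by exists n, m, (kk n), (kk m).
have [|x hx] := complete_dist (u := x_ \o kk).
  move=> e e0; have e2 : 0 < e / 2 by rewrite divr_gt0.
  have [N hN] := r_lt e2; exists N => m n Nm Nn.
  by rewrite (le_lt_trans (dkk m n))// (splitr e) ltrD// hN.
exists x => n k bnk; rewrite (first_uniq bnk (hkk n)).
apply/ler_addgt0Pl => e e0.
have e2 : 0 < e / 2 by rewrite divr_gt0.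
have [N hN] := r_lt e2; have [N' hN'] := hx _ e2.
have := hN _ (leq_maxl N N'); have := hN' _ (leq_maxr N N').
have := dkk n (maxn N N');
  have := dist_triangle (x_ (kk n)) (x_ (kk (maxn N N'))) x.
by move=> /=; lra.
Qed.

Let decode (b : nat -> bool) : X :=
  if pselect (total b /\ compatible b) then xget point (limit b) else point.

Let decodeP b : total b -> compatible b -> limit b (decode b).
Proof.
move=> tb cb; rewrite /decode; case: pselect => /= [_|nG].
  by case: xgetP => // h0; have [x /h0] := limit_ex tb cb.
by exfalso; exact: nG.
Qed.

Let B (m : nat) : set X :=
  if unpickle m is Some (n, k) then [set x | dist (x_ k) x < r n] else set0.

Let decodeK x : decode (fun m => `[< B m x >]) = x.
Proof.
set b := fun m => _.
have bE n k : bit b n k = (dist (x_ k) x < r n).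
  by rewrite /bit /b /B pickleK; apply/asboolP/idP.
have tb : total b.
  by move=> n; apply: first_ex; have [k] := x_dense x (r_gt0 n); exists k;
    rewrite bE.
have cb : compatible b.
  move=> [n [m [k [l [+ [+ _] [+ _]]]]]]; rewrite !bE.
  have := dist_triangle (x_ k) x (x_ l); rewrite (dist_sym x (x_ l)); lra.
have lim := decodeP tb cb.
apply: dist_eq => e e0; have e2 : 0 < e / 2 by rewrite divr_gt0.
have [N /(_ _ (leqnn _)) hN] := r_lt e2.
have [k bk] := tb N; have := lim _ _ bk; have := bk.1; rewrite bE.
by have := dist_triangle (decode b) (x_ k) x; rewrite (dist_sym _ (x_ k)); lra.
Qed.

(** The limit is unknown when the bits are read, but it lies within [r n] of
    the [n]-th selected center; membership in an open set is thus seen on one of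
    the selected balls, once its radius has been doubled. *)
Let decode_open b (O : set X) : open O -> total b -> compatible b ->
  O (decode b) <->
  exists n k, (forall y, dist (x_ k) y < r n + r n -> O y) /\ first b n k.
Proof.
move=> oO tb cb; have lim := decodeP tb cb; split => [Ox|]; last first.
  move=> [n [k [hO bk]]]; apply: hO; have := lim _ _ bk; have := r_gt0 n; lra.
have [e e0 eO] := dball_open oO Ox.
have e3 : 0 < e / 3 by rewrite divr_gt0.
have [N /(_ _ (leqnn _)) hN] := r_lt e3.
have [k bk] := tb N; exists N, k; split => // y hy; apply: eO.
have := lim _ _ bk; have := dist_triangle (decode b) (x_ k) y.
by rewrite (dist_sym _ (x_ k)); lra.
Qed.

Section Measurability.
Context d (S : measurableType d) (b : nat -> S -> bool).
Hypothesis mb : forall n, measurable [set s | b n s].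

Let mfirst n k : measurable [set s | first (b ^~ s) n k].
Proof.
rewrite (_ : mkset _ = [set s | b (pickle (n, k)) s] `&`
    \bigcap_(l in [set l | (l < k)%N]) ~` [set s | b (pickle (n, l)) s]).
  apply: measurableI => //; apply: fin_bigcap_measurable.
    exact: finite_II.
  by move=> l _; exact: measurableC.
apply/seteqP; split => s /= [h1 h2]; split => //.
  by move=> l /= lk; apply/negP; exact: h2.
by move=> l lk; apply/negP; exact: h2.
Qed.

Let mtotal : measurable [set s | total (b ^~ s)].
Proof.
rewrite (_ : mkset _ = \bigcap_n \bigcup_k [set s | first (b ^~ s) n k]).
  by apply: bigcapT_measurable => n; exact: bigcupT_measurable.
apply/seteqP; split => s /= hs.
  by move=> n _; have [k] := hs n; exists k.
by move=> n; have [k _ hk] := hs n I; exists k.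
Qed.

Let mcompatible : measurable [set s | compatible (b ^~ s)].
Proof.
rewrite (_ : mkset _ = ~` \bigcup_n \bigcup_m \bigcup_k
    \bigcup_(l in [set l | r n + r m < dist (x_ k) (x_ l)])
    ([set s | first (b ^~ s) n k] `&` [set s | first (b ^~ s) m l])).
  apply: measurableC; do 3 apply: bigcupT_measurable => ?.
  by apply: bigcup_measurable => l _; exact: measurableI.
apply/seteqP; split => s /= hs; apply: contra_not hs.
  by move=> [n _ [m _ [k _ [l lt [h1 h2]]]]]; exists n, m, k, l.
move=> [n [m [k [l [lt h1 h2]]]]].
by exists n => //; exists m => //; exists k => //; exists l.
Qed.

Let mdecode_open (O : set X) : open O ->
  measurable [set s | O (decode (b ^~ s))].
Proof.
move=> oO.
pose G := [set s | total (b ^~ s)] `&` [set s | compatible (b ^~ s)].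
have mG : measurable G by exact: measurableI.
rewrite (_ : mkset _ = (G `&` \bigcup_n \bigcup_(k in
      [set k | forall y, dist (x_ k) y < r n + r n -> O y])
      [set s | first (b ^~ s) n k]) `|` (~` G `&` [set s | O point])).
  apply: measurableU; apply: measurableI => //.
  - apply: bigcupT_measurable => n; apply: bigcup_measurable => k _ //.
  - exact: measurableC.
  - have [Op|nOp] := pselect (O point).
      by rewrite (_ : mkset _ = setT)//; apply/seteqP; split.
    by rewrite (_ : mkset _ = set0)//; apply/seteqP; split.
apply/seteqP; split => s /=.
  have [[tb cb]|nG] := pselect (G s).
    move=> /(decode_open oO tb cb) [n [k [h1 h2]]]; left; split; first by [].
    by exists n => //; exists k.
  by rewrite {1}/decode; case: pselect => [//|/= _ Op]; right.
move=> [[[tb cb] [n _ [k h1 h2]]]|[nG Op]].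
  by apply/(decode_open oO tb cb); exists n, k.
by rewrite /decode; case: pselect => [//|/= _].
Qed.

Lemma measurable_decode :
  measurable_fun [set: S] (fun s => decode (b ^~ s) : borel X).
Proof. by apply: measurable_to_borel; exact: mdecode_open. Qed.

End Measurability.

Lemma complete_metric_bit_codable : bit_codable (borel X).
Proof.
exists B, decode; split.
- move=> m; rewrite /B; case: unpickle => [[n k]|//].
  by apply: sub_sigma_algebra; exact: open_dball.
- exact: decodeK.
- by move=> d' S b mb; exact: measurable_decode.
Qed.

End PolishBitCodable.

Lemma polish_bit_codable (R : realType) (X : ptopologicalType) :
  polish R X -> bit_codable (borel X).
Proof.
move=> [sepX [M [h [g [hK gK ch cg compM]]]]].
exact: (complete_metric_bit_codable hK ch cg compM sepX).
Qed.

(** * Realising a bimeasure by an auxiliary uniform variable *)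
Section RationalRays.
Variable R : realType.

(** A countable family of rays suffices to determine a law, so that countably
    many densities describe a conditional distribution function. *)
Definition rational_rays : set (set (\bar R)) :=
  [set A | exists q : rat, A = [set x | (x < (ratr q)%:E)%E]].

Lemma rational_rays_setI_closed : setI_closed rational_rays.
Proof.
move=> _ _ [q ->] [q' ->]; exists (Num.min q q').
apply/seteqP; split => x /=.
  by move=> [h1 h2]; rewrite /Num.min; case: ifP.
case: (leP q q') => qq' xq; split => //.
  by apply: lt_le_trans xq _; rewrite lee_fin ler_rat.
by apply: lt_le_trans xq _; rewrite lee_fin ler_rat ltW.
Qed.

Lemma measurable_rational_rays :
  @measurable _ (\bar R) = <<s rational_rays >>.
Proof.
apply/seteqP; split; last first.
  apply: smallest_sub; first exact: sigma_algebra_measurable.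
  move=> _ [q ->].
  rewrite [X in measurable X](_ : _ = `]-oo, (ratr q)%:E[%classic).
    exact: emeasurable_itv.
  by apply/seteqP; split => x /=; rewrite in_itv.
rewrite [X in X `<=` _](ErealGenInftyO.measurableE R).
apply: smallest_sub; first exact: smallest_sigma_algebra.
move=> _ [r ->].
rewrite (_ : [set` _] = \bigcup_n
  (if unpickle n is Some q then
     if (ratr q <= r :> R) then [set x | (x < (ratr q)%:E)%E] else set0
   else set0)).
  apply: sigma_algebra_bigcup => n.
  have s0 : <<s rational_rays >> set0.
    by case: (smallest_sigma_algebra [set: \bar R] rational_rays).
  case: unpickle => [q|//]; case: ifP => // _.
  by apply: sub_sigma_algebra; exists q.
apply/seteqP; split => x /=; rewrite in_itv/=.
  move=> xr; have [q xq qr] : exists2 q : rat, (x < (ratr q)%:E)%E & ratr q < r.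
    case: x xr => [x|//|_].
      rewrite lte_fin => /rat_in_itvoo[q]; rewrite in_itv/= => /andP[? ?].
      by exists q.
    have : r - 1 < r by rewrite ltrBlDr ltrDl.
    move=> /rat_in_itvoo[q]; rewrite in_itv/= => /andP[_ ?].
    by exists q => //; rewrite ltNyr.
  exists (pickle q); first exact: I.
  rewrite pickleK (ltW qr); exact: xq.
move=> [n _]; case: unpickle => [q|//]; case: ifP => // qr /= xq.
by apply: lt_le_trans xq _; rewrite lee_fin.
Qed.

End RationalRays.

Section Uniform.
Variable R : realType.

(** The uniform law of the unit interval, described by its distribution
    function. *)
Lemma uniform01_exists : exists lam : probability R R,
  forall c : R, 0 <= c <= 1 -> lam [set u | u < c] = c%:E.
Proof.
pose idR : measurableTypeR R -> R := id.
have midR : measurable_fun [set: measurableTypeR R] idR.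
  by move=> _ A mA; rewrite setTI.
have [lam lamE] := image_law_exists (uniform_prob (@ltr01 R)) midR.
exists lam => c /andP[c0 c1]; rewrite -lamE; last first.
  rewrite (_ : [set u | u < c] = `]-oo, c[%classic);
    first exact: measurable_itv.
  by apply/seteqP; split => x /=; rewrite in_itv.
rewrite /pushforward/= /uniform_prob integral_uniform_pdf preimage_id.
rewrite (_ : [set u | u < c] `&` `[0, 1]%classic = `[0, c[%classic); last first.
  apply/seteqP; split => x /=; rewrite !in_itv/=.
    by move=> [-> /andP[-> _]].
  by move=> /andP[-> xc]; rewrite xc (ltW (lt_le_trans xc c1)).
under eq_integral.
  move=> x; rewrite inE/= in_itv/= => /andP[x0 xc].
  rewrite /uniform_pdf x0 (ltW (lt_le_trans xc c1))/= subr0 invr1.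
  over.
rewrite integral_cst//= lebesgue_measure_itv/= mul1e lte_fin.
case: ifP => [_|/negbT]; first by rewrite -EFinD subr0.
by rewrite -leNgt => c0'; congr _%:E; apply/eqP; rewrite eq_le c0 c0'.
Qed.

End Uniform.

(** The set function [m] is a bimeasure on Y x Z with marginals dominated by
    [mu] and [nu], as it arises from limits of couplings. *)
Section Randomization.
Context {R : realType} d d' (Y : measurableType d) (Z : measurableType d').
Variables (mu : probability Y R) (nu : probability Z R).
Variable lam : probability R R.
Hypothesis lamE : forall c : R, 0 <= c <= 1 -> lam [set u | u < c] = c%:E.
Variable m : set Y -> set Z -> R.
Hypothesis dm1 : forall C, measurable C -> dominated_additive mu (m ^~ C).
Hypothesis dm2 : forall D, measurable D -> dominated_additive nu (m D).
Hypothesis mT : forall D, measurable D -> (m D setT)%:E = mu D.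

(** Fubini: for fixed [y] a uniform variable is below [F y] with probability
    [F y]. *)
Lemma product_subgraph (F : Y -> R) D : measurable D ->
  measurable_fun [set: Y] F -> (forall y, 0 <= F y <= 1) ->
  (mu \x lam)%E [set w | D w.1 /\ w.2 < F w.1] =
    (\int[mu]_(y in D) (F y)%:E)%E.
Proof.
move=> mD mF F01; rewrite /product_measure1/= [RHS]integral_mkcond.
apply: eq_integral => y _; rewrite patchE /=; case: ifPn => yD.
  rewrite (_ : xsection _ _ = [set u | u < F y]) ?lamE//.
  rewrite inE in yD.
  by apply/seteqP; split => u; rewrite /xsection/= inE/= => //; case.
rewrite (_ : xsection _ _ = set0) ?measure0//.
rewrite notin_setE in yD.
by apply/seteqP; split => u; rewrite /xsection/= inE/= => //; case.
Qed.

(** [F q y] is the conditional probability of [i z < q] given [y]: the density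
    of [m ^~ [set z | i z < q]] with respect to [mu].  The densities are
    monotone in [q] and at most 1 only almost everywhere; there are countably
    many conditions, so they are set to 0 on one null set [N]. *)
Let conditional_cdf (i : Z -> \bar R) : measurable_fun [set: Z] i ->
  exists F : rat -> Y -> R,
  [/\ forall q, measurable_fun setT (F q),
      forall q y, 0 <= F q y <= 1,
      forall q q' y, q <= q' -> F q y <= F q' y &
      forall q D, measurable D ->
        (\int[mu]_(y in D) (F q y)%:E =
         (m D [set z | (i z < (ratr q)%:E)%E])%:E)%E].
Proof.
move=> mi; pose C q := [set z | (i z < (ratr q)%:E)%E].
have mC q : measurable (C q).
  rewrite (_ : C q = i @^-1` `]-oo, (ratr q)%:E[%classic).
    by apply: (preimage_measurable mi); exact: emeasurable_itv.
  by apply/seteqP; split => z; rewrite /C/= in_itv.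
have /choice[f hf] := fun q => dominated_additive_density (dm1 (mC q)).
have mf q : measurable_fun [set: Y] (f q) by case: (hf q).
have f0 q y : 0 <= f q y by case: (hf q).
have fi q : mu.-integrable setT (EFin \o f q) by case: (hf q).
have fE q D : measurable D -> (\int[mu]_(y in D) (f q y)%:E = (m D (C q))%:E)%E.
  by case: (hf q) => _ _ _; exact.
have ae1 : \forall y \ae mu, forall q, f q y <= 1.
  apply: ae_forall_countable => q; apply: density_le => //.
    exact: finite_measure_integrable_cst.
  move=> A mA; rewrite fE// integral_cst// mul1e.
  exact: ((dm1 (mC q)).1 _ mA).2.
have ae2 : \forall y \ae mu, forall r : rat * rat,
    r.1 <= r.2 -> f r.1 y <= f r.2 y.
  apply: ae_forall_countable => -[q q'] /=.
  have [qq'|qq'] := leP q q'; last exact: nearW.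
  have : \forall y \ae mu, f q y <= f q' y.
    apply: density_le => // A mA; rewrite !fE// lee_fin.
    apply: (dominated_additive_le (dm2 mA)) => // z /= h.
    by apply: lt_le_trans h _; rewrite lee_fin ler_rat.
  exact: filterS.
have [N [mN N0 hN]] := filterI ae1 ae2.
have ok y : ~ N y -> (forall q, f q y <= 1) /\
    (forall q q', q <= q' -> f q y <= f q' y).
  move=> nNy; apply: contrapT => h; apply: nNy; apply: hN => -[h1 h2]; apply: h.
  by split=> // q q'; exact: (h2 (q, q')).
exists (fun q y => f q y * \1_(~` N) y); split.
- move=> q; apply: measurable_funM => //; apply: measurable_indic.
  exact: measurableC.
- move=> q y; rewrite indicE; have [nNy|] := boolP (y \in ~` N).
    rewrite mulr1 f0/=; rewrite inE in nNy; exact: (ok _ nNy).1.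
  by rewrite mulr0 lexx ler01.
- move=> q q' y qq'; rewrite indicE; have [nNy|] := boolP (y \in ~` N).
    rewrite !mulr1; rewrite inE in nNy; exact: (ok _ nNy).2.
  by rewrite !mulr0.
- move=> q D mD; rewrite -fE//; apply: ae_eq_integral => //.
  + apply/measurable_EFinP; apply: measurable_funTS;
    apply: measurable_funM => //.
    by apply: measurable_indic; exact: measurableC.
  + by apply/measurable_EFinP; exact: measurable_funTS.
  + exists N; split => // y /= h; apply: contrapT => nNy; apply: h => _.
    by rewrite indicE mem_set ?mulr1.
Qed.

(** The quantile transform.  With [i] a measurable injection of Z into the line
    and [j] a left inverse, let Q(y, u) be the infimum of the rationals q with
    u < F_q(y).  Given y, Q has the conditional law of i(z), so that T = j(Q)
    has that of z.  The comparison with [m D] is made on rays and extended by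
    uniqueness of dominated additive functions. *)
Lemma randomization : bit_codable Z ->
  exists T : Y * R -> Z, measurable_fun [set: Y * R] T /\
    forall D C, measurable D -> measurable C ->
      ((mu \x lam) [set w | D w.1 /\ C (T w)] = (m D C)%:E)%E.
Proof.
move=> /(@bit_codable_retract R)[i [j [mi mj ij]]].
have mei : measurable_fun [set: Z] (EFin \o i) by apply/measurable_EFinP.
have [F [mF F01 ndF FE]] := conditional_cdf mei.
pose Q (w : Y * R) : \bar R :=
  ereal_inf [set (ratr q)%:E | q in [set q : rat | w.2 < F q w.1]].
(* an infimum is below s exactly when one of its terms is *)
have QE (s : R) : [set w | (Q w < s%:E)%E] =
    \bigcup_(q in [set q : rat | ratr q < s]) [set w | w.2 < F q w.1].
  apply/seteqP; split => w /=.
    by move=> /ereal_inf_lt[_ [q /= wq <-]]; rewrite lte_fin => qs; exists q.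
  move=> [q /= qs wq]; apply: (@le_lt_trans _ _ (ratr q)%:E); last
    by rewrite lte_fin.
  by apply: ereal_inf_lbound; exists q.
have mE q : measurable [set w : Y * R | w.2 < F q w.1].
  apply: measurable_ltr_set => //.
  exact: (measurableT_comp (mF q) measurable_fst).
have mQ : measurable_fun [set: Y * R] Q.
  apply: (measurability _ (ErealGenInftyO.measurableE R)) => //.
  move=> _ [_ [s ->] <-]; rewrite setTI.
  rewrite [X in measurable X](_ : _ = [set w | (Q w < s%:E)%E]); last first.
    by apply/seteqP; split => w /=; rewrite in_itv.
  rewrite QE bigcup_mkcond; apply: countable_bigcupT_measurable => // q.
  by case: ifP.
have mT' : measurable_fun [set: Y * R] (j \o fine \o Q).
  by apply: measurableT_comp mQ; exact: measurableT_comp.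
exists (j \o fine \o Q); split => // D C mD mC.
pose P : probability (Y * R)%type R := (mu \x lam)%E.
have mDw : measurable [set w : Y * R | D w.1].
  exact: (preimage_measurable measurable_fst).
have mQE E : measurable E -> measurable [set w | E (Q w)].
  exact: preimage_measurable.
have miE E : measurable E -> measurable [set z | E (i z)%:E].
  exact: (preimage_measurable mei).
have [nuQ nuQE] := image_law_exists P mQ.
have [nui nuiE] := image_law_exists nu mei.
pose a E := fine (P [set w | D w.1 /\ E (Q w)]).
pose b E := m D [set z | E (i z)%:E].
have dP := probability_dominated_additive P.
have da : dominated_additive nuQ a by exact: image_law_dominated.
have db : dominated_additive nui b.
  exact: (dominated_additive_pullback mei nuiE (dm2 mD)).
have aT : a setT = b setT.
  rewrite /a /b (_ : [set w | _ /\ _] = [set w | D w.1]); last first.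
    by apply/seteqP; split => w //= -[].
  have -> : P [set w | D w.1] = mu D by exact: product_probability_fst.
  by rewrite -mT//=; congr (m D _); apply/seteqP.
have ray A : rational_rays A -> a A = b A.
  move=> [q0 ->].
  (* the ray below q0 is the increasing union of those below q_ n, on which
     F (q_ n) integrates to m *)
  pose q_ n : rat := q0 - n.+1%:R^-1.
  have q_nd : nondecreasing_seq q_.
    by move=> k l kl; rewrite /q_ lerD2l lerN2 lef_pV2 ?posrE// ler_nat.
  have q_lt n : q_ n < q0 by rewrite /q_ ltrBlDr ltrDl.
  have q_cof q : q < q0 -> exists n, q <= q_ n.
    move=> qq0; have q0q : 0 < q0 - q by rewrite subr_gt0.
    have [n _ /(_ _ (leqnn _)) hn] := near_infty_natSinv_lt (PosNum q0q).
    by exists n; rewrite /q_ lerBrDl -lerBrDr; exact: ltW.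
  pose E n := [set w | D w.1 /\ w.2 < F (q_ n) w.1].
  pose C' n := [set z | ((i z)%:E < (ratr (q_ n))%:E)%E].
  have mE' n : measurable (E n) by exact: (measurableI _ _ mDw (mE (q_ n))).
  have mC' n : measurable (C' n).
    apply: (miE [set x | (x < (ratr (q_ n))%:E)%E]).
    rewrite measurable_rational_rays; apply: sub_sigma_algebra.
    by exists (q_ n).
  have EC n : fine (P (E n)) = m D (C' n).
    by rewrite /P/= product_subgraph// FE.
  have ndE : nondecreasing_seq E.
    move=> k l kl; apply/subsetPset => w /= [Dw h]; split => //.
    by apply: lt_le_trans h _; apply: ndF; exact: q_nd.
  have ndC : nondecreasing_seq C'.
    move=> k l kl; apply/subsetPset => z /= h.
    by apply: lt_le_trans h _; rewrite lee_fin ler_rat; exact: q_nd.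
  rewrite /a /b.
  rewrite (_ : [set w | _ /\ _] = \bigcup_n E n); last first.
    apply/seteqP; split => w /=.
      rewrite -[X in _ /\ X -> _]/([set w | (Q w < (ratr q0)%:E)%E] w) QE.
      move=> [Dw [q /=]]; rewrite ltr_rat => /q_cof[n qn] wq.
      by exists n => //; split => //; apply: lt_le_trans wq _; exact: ndF.
    move=> [n _ [Dw wq]]; split => //.
    suff : [set w | (Q w < (ratr q0)%:E)%E] w by [].
    rewrite QE; by exists (q_ n) => //=; rewrite ltr_rat.
  rewrite (_ : [set z | _] = \bigcup_n C' n); last first.
    apply/seteqP; split => z /=.
      rewrite lte_fin => /rat_in_itvoo[q]; rewrite in_itv/= => /andP[zq].
      rewrite ltr_rat => /q_cof[n qn]; exists n => //=.
      by rewrite /C'/= lte_fin; apply: lt_le_trans zq _; rewrite ler_rat.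
    move=> [n _ /=]; rewrite /C'/= => h; apply: lt_trans h _.
    by rewrite lte_fin ltr_rat.
  have h1 := dominated_additive_cvg_nondecreasing dP mE' ndE.
  have h2 := dominated_additive_cvg_nondecreasing (dm2 mD) mC' ndC.
  rewrite -(cvg_lim (@Rhausdorff R) h1) -(cvg_lim (@Rhausdorff R) h2).
  by rewrite (_ : (fun n => fine (P (E n))) = (fun n => m D (C' n)))//;
    exact/funext.
pose E := [set x : \bar R | C (j (fine x))].
have mE' : measurable E.
  have mjf := measurableT_comp mj (fine_measurable measurableT).
  exact: (preimage_measurable mjf mC).
have aE := dominated_additive_unique (@measurable_rational_rays R)
  (@rational_rays_setI_closed R) da db aT ray mE'.
have bE : b E = m D C.
  by rewrite /b /E; congr (m D _); apply/seteqP; split => z /=; rewrite ij.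
have mS := measurableI _ _ mDw (mQE _ mE').
rewrite -bE -aE; apply/esym/fineK; exact: (fin_num_measure P _ mS).
Qed.

End Randomization.

(** * Gluing and limits of couplings *)
Section Gluing.
Context {R : realType} d1 d2 (Y : measurableType d1) (Z : measurableType d2).
Variables (lam : probability R R).
Hypothesis lamE : forall c : R, 0 <= c <= 1 -> lam [set u | u < c] = c%:E.

(** A coupling of [mu] and [nu] is in particular a bimeasure; this is a
    disintegration of [pi] over [mu] in functional form. *)
Lemma coupling_randomization (mu : probability Y R) (nu : probability Z R)
    (pi : probability (Y * Z)%type R) : bit_codable Z ->
  image_law pi fst mu -> image_law pi snd nu ->
  exists h : Y * R -> Z, measurable_fun [set: Y * R] h /\
    image_law (mu \x lam)%E (fun w => (w.1, h w)) pi.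
Proof.
move=> bZ pimu pinu.
pose m A B := fine (pi (A `*` B)).
have dm1 C : measurable C -> dominated_additive mu (m ^~ C).
  move=> mC; have mC' : measurable (snd @^-1` C : set (Y * Z)).
    exact: (preimage_measurable measurable_snd).
  rewrite (_ : m ^~ C = fun A => fine (pi (snd @^-1` C `&` fst @^-1` A))).
    exact: image_law_dominated.
  apply/funext => A; congr (fine (pi _)).
  by apply/seteqP; split => -[y z] /= [].
have dm2 D : measurable D -> dominated_additive nu (m D).
  move=> mD; have mD' : measurable (fst @^-1` D : set (Y * Z)).
    exact: (preimage_measurable measurable_fst).
  rewrite (_ : m D = fun A => fine (pi (fst @^-1` D `&` snd @^-1` A))).
    exact: image_law_dominated.
  by apply/funext => A; congr (fine (pi _)).
have mT D : measurable D -> (m D setT)%:E = mu D.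
  move=> mD; rewrite /m fineK; last by apply: fin_num_measure;
    exact: measurableX.
  rewrite -pimu// /pushforward; congr (pi _).
  by apply/seteqP; split => -[y z] /= // [].
have [h [mh hE]] := randomization lamE dm1 dm2 mT bZ.
exists h; split=> // A mA.
have mfh : measurable_fun setT (fun w : Y * R => (w.1, h w)).
  exact: measurable_fun_pair.
pose P : probability (Y * R)%type R := (mu \x lam)%E.
have [pi' pi'E] := image_law_exists P mfh.
transitivity (pi' A); first exact: pi'E.
apply: probability_rectangles_unique mA => B C mB mC.
rewrite -pi'E; last exact: measurableX.
rewrite [LHS](hE _ _ mB mC) /m fineK//.
by apply: fin_num_measure; exact: measurableX.
Qed.

(** Let (x, y) have law [pi1] and let [u] be uniform and independent; then
    z = h(y, u), where [h] realises [pi2], makes (y, z) have law [pi2]. *)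
Lemma gluing d3 (X : measurableType d3) (mu : probability Y R)
    (nu : probability Z R) (pi1 : probability (X * Y)%type R)
    (pi2 : probability (Y * Z)%type R) : bit_codable Z ->
  image_law pi1 snd mu -> image_law pi2 fst mu -> image_law pi2 snd nu ->
  exists (P : probability ((X * Y) * R)%type R) (h : (X * Y) * R -> Z),
  [/\ measurable_fun [set: (X * Y) * R] h, image_law P fst pi1 &
      image_law P (fun w => (w.1.2, h w)) pi2].
Proof.
move=> bZ pi1mu pi2mu pi2nu.
have [h [mh hE]] := coupling_randomization bZ pi2mu pi2nu.
pose P : probability ((X * Y) * R)%type R := (pi1 \x lam)%E.
pose s (w : (X * Y) * R) : Y * R := (w.1.2, w.2).
have ms : measurable_fun setT s.
  apply: measurable_fun_pair => //.
  exact: (measurableT_comp measurable_snd measurable_fst).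
have sE : image_law P s (mu \x lam)%E.
  move=> A mA; have [Q QE] := image_law_exists P ms.
  pose ml : probability (Y * R)%type R := (mu \x lam)%E.
  transitivity (Q A); first exact: QE.
  apply: (probability_rectangles_unique (Q := ml)) mA => B C mB mC.
  rewrite -QE; last exact: measurableX.
  have mB' : measurable (snd @^-1` B : set (X * Y)).
    exact: (preimage_measurable measurable_snd).
  transitivity (pi1 (snd @^-1` B) * lam C)%E.
    exact: (product_measure1E pi1 lam mB' mC).
  by rewrite [pi1 _](pi1mu B mB); apply/esym/product_measure1E.
exists P, (h \o s); split.
- exact: measurableT_comp.
- by move=> A mA; exact: product_probability_fst.
- apply: (image_law_comp _ sE hE).
  exact: measurable_fun_pair.
Qed.

End Gluing.

Section LimitCoupling.
Context {R : realType} d1 d2 (X : measurableType d1) (Y : measurableType d2).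
Variables (mu : probability X R) (nu : probability Y R).

(** The product of [P] and [Q], with the coordinates of the four points in the
    order of (X x Y) x (X x Y). *)
Definition box (P : set (X * X)) (Q : set (Y * Y)) : set ((X * Y) * (X * Y)) :=
  square_map fst @^-1` P `&` square_map snd @^-1` Q.

Lemma measurable_box P Q : measurable P -> measurable Q -> measurable (box P Q).
Proof.
move=> mP mQ; apply: measurableI.
  exact: (preimage_measurable (measurable_square_map measurable_fst)).
exact: (preimage_measurable (measurable_square_map measurable_snd)).
Qed.

(** An ultrafilter makes the masses of all rectangles converge at once, without
    extracting a subsequence.  Their limit [m] is a bimeasure, realised by a
    coupling [pi].  For [pi_ n \x pi_ n] the mass of a box over rectangles
    A1 x A2 and B1 x B2 is a product of masses of rectangles, hence converges;
    fixing the second component, then the first, the convergence extends to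
    all boxes because their marginals are the fixed laws mu x mu and nu x nu. *)
Lemma limit_coupling (pi_ : nat -> probability (X * Y)%type R) :
  bit_codable Y ->
  (forall n, image_law (pi_ n) fst mu /\ image_law (pi_ n) snd nu) ->
  exists pi : probability (X * Y)%type R,
  [/\ image_law pi fst mu, image_law pi snd nu &
    forall P Q, measurable P -> measurable Q ->
      fine ((pi_ n \x pi_ n)%E (box P Q)) @[n --> \oo] --> (0 : R) ->
      (pi \x pi)%E (box P Q) = 0%E].
Proof.
move=> bY cpl; have [U [UU ooU]] := ultraFilterLemma (@eventually_filter).
have [lam lamE] := uniform01_exists R.
have mX A : measurable A -> measurable (fst @^-1` A : set (X * Y)).
  exact: (preimage_measurable measurable_fst).
have mY A : measurable A -> measurable (snd @^-1` A : set (X * Y)).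
  exact: (preimage_measurable measurable_snd).
pose m A B : R := lim (fine (pi_ n (fst @^-1` A `&` snd @^-1` B)) @[n --> U]).
have cm A B : measurable A -> measurable B ->
    fine (pi_ n (fst @^-1` A `&` snd @^-1` B)) @[n --> U] --> m A B.
  move=> mA mB.
  have [n|l hl] := @ultrafilter_cvg R U
    (fun n => fine (pi_ n (fst @^-1` A `&` snd @^-1` B))) 0 1 UU.
    have mAB : measurable (fst @^-1` A `&` snd @^-1` B : set (X * Y)).
      by apply: measurableI; [exact: mX|exact: mY].
    rewrite fine_ge0//= -lee_fin fineK ?fin_num_measure//.
    exact: probability_le1.
  exact: (cvgP l hl).
have dm1 C : measurable C -> dominated_additive mu (m ^~ C).
  move=> mC; apply: (dominated_additive_cvg (F := U)
    (a_ := fun n A => fine (pi_ n (snd @^-1` C `&` fst @^-1` A)))).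
    move=> n; apply: image_law_dominated => //; [exact: (cpl n).1|exact: mY].
  by move=> A mA; under eq_fun do rewrite setIC; exact: cm.
have dm2 D : measurable D -> dominated_additive nu (m D).
  move=> mD; apply: (dominated_additive_cvg (F := U)
    (a_ := fun n A => fine (pi_ n (fst @^-1` D `&` snd @^-1` A)))).
    move=> n; apply: image_law_dominated => //; [exact: (cpl n).2|exact: mX].
  by move=> A mA; exact: cm.
have mT D : measurable D -> (m D setT)%:E = mu D.
  move=> mD; rewrite /m.
  under eq_fun do rewrite preimage_setT setIT [pi_ _ _]((cpl _).1 D mD).
  rewrite lim_cst// fineK//; exact: fin_num_measure.
have mT' D : measurable D -> (m setT D)%:E = nu D.
  move=> mD; rewrite /m.
  under eq_fun do rewrite preimage_setT setTI [pi_ _ _]((cpl _).2 D mD).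
  rewrite lim_cst// fineK//; exact: fin_num_measure.
have [h [mh hE]] := randomization lamE dm1 dm2 mT bY.
have mfh : measurable_fun setT (fun w : X * R => (w.1, h w)).
  exact: measurable_fun_pair.
pose P : probability (X * R)%type R := (mu \x lam)%E.
have [pi piE] := image_law_exists P mfh.
have pim A B : measurable A -> measurable B ->
    pi (fst @^-1` A `&` snd @^-1` B) = (m A B)%:E.
  move=> mA mB; rewrite -piE; first exact: hE.
  by apply: measurableI; [exact: mX|exact: mY].
have pimu : image_law pi fst mu.
  move=> A mA; rewrite -mT// -pim//; congr (pi _).
  by rewrite preimage_setT setIT.
have pinu : image_law pi snd nu.
  move=> A mA; rewrite -mT'// -pim//; congr (pi _).
  by rewrite preimage_setT setTI.
exists pi; split => // A B mA mB pi_0.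
pose a n A B := fine ((pi_ n \x pi_ n)%E (box A B)).
pose b A B := fine ((pi \x pi)%E (box A B)).
pose mu2 : probability (X * X)%type R := (mu \x mu)%E.
pose nu2 : probability (Y * Y)%type R := (nu \x nu)%E.
have dab (pi' : probability (X * Y)%type R) C : measurable C ->
  image_law pi' fst mu ->
    dominated_additive mu2 (fun A => fine ((pi' \x pi')%E (box A C))).
  move=> mC pi'mu; rewrite (_ : (fun _ => _) = (fun A =>
    fine ((pi' \x pi')%E (square_map snd @^-1` C `&` square_map fst @^-1` A)))).
    apply: image_law_dominated.
    - exact: measurable_square_map.
    - exact: image_law_square.
    - exact: (preimage_measurable (measurable_square_map measurable_snd)).
  by apply/funext => A'; rewrite setIC.
have dab' (pi' : probability (X * Y)%type R) C : measurable C ->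
  image_law pi' snd nu ->
    dominated_additive nu2 (fun B => fine ((pi' \x pi')%E (box C B))).
  move=> mC pi'nu; apply: image_law_dominated.
  - exact: measurable_square_map.
  - exact: image_law_square.
  - exact: (preimage_measurable (measurable_square_map measurable_fst)).
have boxT (pi' : probability (X * Y)%type R) A' : measurable A' ->
  image_law pi' fst mu ->
    (pi' \x pi')%E (box A' setT) = mu2 A'.
  move=> mA' pi'mu; rewrite /box preimage_setT setIT.
  exact: (image_law_square measurable_fst pi'mu).
have boxT' (pi' : probability (X * Y)%type R) B' : measurable B' ->
  image_law pi' snd nu ->
    (pi' \x pi')%E (box setT B') = nu2 B'.
  move=> mB' pi'nu; rewrite /box preimage_setT setTI.
  exact: (image_law_square measurable_snd pi'nu).
have c1 (A1 A2 : set X) (B1 B2 : set Y) : measurable A1 -> measurable A2 ->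
    measurable B1 -> measurable B2 ->
    a n (A1 `*` A2) (B1 `*` B2) @[n --> U] --> b (A1 `*` A2) (B1 `*` B2).
  move=> mA1 mA2 mB1 mB2.
  have e (pi' : probability (X * Y)%type R) :
      fine ((pi' \x pi')%E (box (A1 `*` A2) (B1 `*` B2))) =
      fine (pi' (fst @^-1` A1 `&` snd @^-1` B1)) *
      fine (pi' (fst @^-1` A2 `&` snd @^-1` B2)).
    have m1 : measurable (fst @^-1` A1 `&` snd @^-1` B1 : set (X * Y)).
      by apply: measurableI; [exact: mX|exact: mY].
    have m2 : measurable (fst @^-1` A2 `&` snd @^-1` B2 : set (X * Y)).
      by apply: measurableI; [exact: mX|exact: mY].
    rewrite -fineM ?fin_num_measure// -(product_measure1E pi' pi' m1 m2).
    congr (fine _); congr ((_ \x _)%E _); apply/seteqP.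
    by split => -[[x y] [x' y']] /= [[? ?] [? ?]].
  rewrite /b e /a; under eq_fun do rewrite e.
  by apply: cvgM; rewrite pim//=; exact: cm.
have c2 A' (B1 B2 : set Y) : measurable A' -> measurable B1 -> measurable B2 ->
    a n A' (B1 `*` B2) @[n --> U] --> b A' (B1 `*` B2).
  move=> mA' mB1 mB2; have mB12 : measurable (B1 `*` B2) by exact: measurableX.
  apply: (cvg_dominated_additive (a_ := fun n A => a n A (B1 `*` B2))
    (a := b ^~ (B1 `*` B2)) (measurable_prod_measurableType X X)
    (@rectangles_setI_closed _ _ X X)) mA'.
  - by move=> n; apply: dab => //; exact: (cpl n).1.
  - exact: dab.
  - rewrite /a /b boxT'//;
    under eq_fun => n do rewrite (boxT' _ _ mB12 (cpl n).2).
    exact: cvg_cst.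
  - by move=> _ [A1 mA1 [A2 mA2 <-]]; exact: c1.
have c3 A' B' : measurable A' -> measurable B' -> a n A' B' @[n --> U] -->
  b A' B'.
  move=> mA' mB'.
  apply: (cvg_dominated_additive (a_ := fun n B => a n A' B)
    (a := b A') (measurable_prod_measurableType Y Y)
    (@rectangles_setI_closed _ _ Y Y)) mB'.
  - by move=> n; apply: dab' => //; exact: (cpl n).2.
  - exact: dab'.
  - rewrite /a /b boxT//; under eq_fun => n do rewrite (boxT _ _ mA' (cpl n).1).
    exact: cvg_cst.
  - by move=> _ [B1 mB1 [B2 mB2 <-]]; exact: c2.
have a0 : a n A B @[n --> U] --> (0 : R) by move=> V /pi_0; exact: ooU.
have b0 : b A B = 0.
  by rewrite -(cvg_lim (@Rhausdorff R) (c3 A B mA mB)); exact: cvg_lim.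
have mAB := measurable_box mA mB.
rewrite -[LHS]fineK; first by rewrite [fine _]b0.
pose pi2 : probability ((X * Y) * (X * Y))%type R := (pi \x pi)%E.
exact: (fin_num_measure pi2 _ mAB).
Qed.

End LimitCoupling.

(** * L^p norms with respect to a probability *)
Section LnormComplements.
Context {R : realType} d (T : measurableType d) (P : probability T R).
Variables (p : \bar R) (p1 : (1 <= p)%E).
Implicit Types f g : T -> R.

Lemma le_Lnorm f g : measurable_fun [set: T] f -> measurable_fun [set: T] g ->
  (forall x, 0 <= f x <= g x) ->
  ('N[P]_p[EFin \o f] <= 'N[P]_p[EFin \o g])%E.
Proof.
move=> mf mg fg; rewrite unlock; case: p p1 => [r||//] h1.
- have r0 : 0 < r by move: h1; rewrite lee_fin; exact: lt_le_trans.
  have mpow (h : T -> R) : measurable_fun [set: T] h ->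
      measurable_fun [set: T] (fun x => (`|(EFin \o h) x| `^ r)%E).
    move=> mh; apply: (@measurableT_comp _ _ _ _ _ _
      (fun x : \bar R => x `^ r)%E).
      exact: measurable_poweR.
    by apply: measurableT_comp => //; exact/measurable_EFinP.
  apply: gt0_ler_poweR.
  + by rewrite invr_ge0 ltW.
  + by rewrite in_itv/= leey andbT; apply: integral_ge0 => x _;
    rewrite lee_fin powR_ge0.
  + by rewrite in_itv/= leey andbT; apply: integral_ge0 => x _;
    rewrite lee_fin powR_ge0.
  + apply: ge0_le_integral => //; [|exact: mpow|exact: mpow|].
      by move=> x _; exact: poweR_ge0.
    move=> x _; have /andP[f0 fgx] := fg x.
    rewrite /= !ger0_norm ?(le_trans f0 fgx)// lee_fin.
    by apply: ge0_ler_powR; rewrite ?nnegrE ?(le_trans f0 fgx)// ltW.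
- case: ifP => // _; apply: le_ess_sup; apply: nearW => x /=.
  have /andP[f0 fgx] := fg x.
  by rewrite !ger0_norm ?(le_trans f0 fgx)// lee_fin.
Qed.

Lemma Lnorm_cst_lty (c : R) : ('N[P]_p[EFin \o cst c] < +oo)%E.
Proof.
case: p p1 => [r||//] h1.
  have := Lfun_cst P c r.
  by rewrite inE/= => /andP[_]; rewrite inE.
rewrite unlock; have PT : (0 < P setT)%E by rewrite probability_setT lte01.
rewrite PT (@ess_sup_ae_cst _ _ _ _ _ `|c|%:E) ?ltry//.
by apply: nearW.
Qed.

Lemma Lnorm_addr_lty f g : measurable_fun [set: T] f ->
  measurable_fun [set: T] g ->
  ('N[P]_p[EFin \o f] < +oo)%E -> ('N[P]_p[EFin \o g] < +oo)%E ->
  ('N[P]_p[EFin \o (fun x => f x + g x)%R] < +oo)%E.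
Proof.
move=> mf mg hf hg; apply: le_lt_trans (eminkowski P mf mg p1) _.
exact: lte_add_pinfty.
Qed.

Lemma Lnorm_ae0 f : measurable_fun [set: T] f ->
  (\forall x \ae P, f x = 0) -> 'N[P]_p[EFin \o f]%E = 0%E.
Proof.
move=> mf f0; case: p p1 => [r||//] h1; rewrite unlock.
- have r0 : 0 < r by move: h1; rewrite lee_fin; exact: lt_le_trans.
  rewrite (ae_eq_integral (cst 0%E))//.
  + by rewrite integral_cst// mul0e poweR0r// invr_neq0// gt_eqF.
  + apply: (@measurableT_comp _ _ _ _ _ _ (fun x : \bar R => x `^ r)%E).
      exact: measurable_poweR.
    by apply: measurableT_comp => //; exact/measurable_EFinP.
  + by apply: filterS f0 => x /= -> _; rewrite normr0 powR0// gt_eqF.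
- have PT : (0 < P setT)%E by rewrite probability_setT lte01.
  rewrite PT; apply: abs_ess_sup_eq0 => //.
  by apply: filterS f0 => x /= -> _.
Qed.

(** A form of Chebyshev's inequality common to all exponents, the essential
    supremum included: as P(A) <= 1, it is bounded by its power 1/p. *)
Lemma Lnorm_ge_measure f (A : set T) (c : R) : measurable_fun [set: T] f ->
  measurable A -> 0 <= c -> (forall x, 0 <= f x) ->
  (forall x, A x -> c <= f x) ->
  (c%:E * P A <= 'N[P]_p[EFin \o f])%E.
Proof.
move=> mf mA c0 f0 cf.
apply: (@le_trans _ _ 'N[P]_p[EFin \o (fun x => c * \1_A x)%R]%E); last first.
  apply: le_Lnorm => //.
    by apply: measurable_funM => //; exact: measurable_indic.
  move=> x; rewrite mulr_ge0//= indicE.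
  have [|] := boolP (x \in A); last by rewrite mulr0.
  by rewrite inE => /cf; rewrite mulr1.
have PA1 := probability_le1 P mA.
case: p p1 => [r||//] h1; rewrite unlock.
- have r0 : 0 < r by move: h1; rewrite lee_fin; exact: lt_le_trans.
  rewrite (eq_integral (fun x => (c `^ r)%:E * (\1_A x)%:E)%E); last first.
    move=> x _ /=; rewrite indicE; case: (x \in A).
      by rewrite !mulr1 ger0_norm// mule1.
    by rewrite !mulr0 normr0 powR0 ?gt_eqF// mule0.
  rewrite ge0_integralZl//; last 2 first.
    by apply/measurable_EFinP; exact: measurable_indic.
    by rewrite lee_fin powR_ge0.
  rewrite integral_indic// setIT poweRM//; last first.
    by rewrite lee_fin powR_ge0.
  rewrite poweR_EFin -powRrM divff ?gt_eqF// powRr1//.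
  apply: lee_wpmul2l => //.
  have PAf : P A \is a fin_num by exact: fin_num_measure.
  change (P A <= P A `^ r^-1)%E; rewrite -(fineK PAf) poweR_EFin lee_fin.
  have [->|PA0] := eqVneq (fine (P A)) 0; first exact: powR_ge0.
  apply: ger1_powR.
    by rewrite lt_def PA0 fine_ge0//= -lee_fin fineK.
  by rewrite invf_le1// -lee_fin.
- have PT : (0 < P setT)%E by rewrite probability_setT lte01.
  rewrite PT; have [->|PA0] := eqVneq (P A) 0%E.
    rewrite mule0; apply: ess_sup_gee => //; apply: nearW => x /=.
    by rewrite lee_fin.
  apply: (@le_trans _ _ c%:E).
    by rewrite -[leRHS]mule1; apply: lee_wpmul2l.
  rewrite leNgt; apply/negP => hlt.
  have := ess_sup_ge P (abse \o (EFin \o (fun x => c * \1_A x)%R)).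
  move=> [N [mN N0 hN]]; case/negP: PA0; apply/eqP.
  apply: (subset_measure0 mA mN _ N0) => x Ax; apply: hN => /= h.
  move: (le_lt_trans h hlt); rewrite indicE mem_set// mulr1 ger0_norm//.
  by rewrite ltxx.
Qed.

End LnormComplements.

(** * Weighted l^q norms of triples *)
Section WeightedPowerMean.
Context {R : realType}.
Variables (q : R) (q1 : 1 <= q).
Variables (w1 w2 w3 : R).
Hypotheses (w1_ge0 : 0 <= w1) (w2_ge0 : 0 <= w2) (w3_ge0 : 0 <= w3).

Definition weighted_norm (a1 a2 a3 : R) : R :=
  (w1 * a1 `^ q + w2 * a2 `^ q + w3 * a3 `^ q) `^ q^-1.

Let q0 : 0 < q. Proof. exact: lt_le_trans q1. Qed.
Let qN0 : q != 0. Proof. by rewrite gt_eqF. Qed.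

Let root_le (x y : R) : 0 <= x -> 0 <= y -> x <= y `^ q -> x `^ q^-1 <= y.
Proof.
move=> x0 y0 xy; rewrite -[leRHS]powRr1// -(divff qN0) powRrM.
by apply: ge0_ler_powR; rewrite ?nnegrE ?invr_ge0 ?(ltW q0) ?powR_ge0.
Qed.

Let powRK (x : R) : 0 <= x -> (x `^ q^-1) `^ q = x.
Proof. by move=> x0; rewrite -powRrM mulVf// powRr1. Qed.

Let sum_ge0 a1 a2 a3 : 0 <= w1 * a1 `^ q + w2 * a2 `^ q + w3 * a3 `^ q.
Proof. by rewrite !addr_ge0// mulr_ge0// powR_ge0. Qed.

Lemma weighted_norm_le_sum a1 a2 a3 : w1 + w2 + w3 <= 1 ->
  0 <= a1 -> 0 <= a2 -> 0 <= a3 -> weighted_norm a1 a2 a3 <= a1 + a2 + a3.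
Proof.
move=> w_le1 a10 a20 a30; apply: root_le => //; first by rewrite !addr_ge0.
have s0 : 0 <= a1 + a2 + a3 by rewrite !addr_ge0.
set s := a1 + a2 + a3 in s0 *.
have le a : 0 <= a -> a <= s -> a `^ q <= s `^ q.
  by move=> *; apply: ge0_ler_powR; rewrite ?nnegrE ?(ltW q0).
have h1 : a1 `^ q <= s `^ q by apply: le => //; rewrite /s; lra.
have h2 : a2 `^ q <= s `^ q by apply: le => //; rewrite /s; lra.
have h3 : a3 `^ q <= s `^ q by apply: le => //; rewrite /s; lra.
have := ler_wpM2l w1_ge0 h1; have := ler_wpM2l w2_ge0 h2.
have := ler_wpM2l w3_ge0 h3; have := ler_piMl (powR_ge0 s q) w_le1.
lra.
Qed.

Let convex l x y : 0 <= l <= 1 -> 0 <= x -> 0 <= y ->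
  (l * x + (1 - l) * y) `^ q <= l * x `^ q + (1 - l) * y `^ q.
Proof.
move=> /andP[l0 l1] x0 y0.
by apply: (convex_powR q1 (Itv01 l0 l1)) => //=; rewrite inE/= in_itv/= andbT.
Qed.

(** Convexity at the point (a + b) / (s + t), the mean of a / s and b / t with
    weights s / (s + t) and t / (s + t). *)
Let convex_scaled s t a b : 0 < s -> 0 < t -> 0 <= a -> 0 <= b ->
  (a + b) `^ q <= (s + t) `^ q *
    (s / (s + t) * (a `^ q / s `^ q) + t / (s + t) * (b `^ q / t `^ q)).
Proof.
move=> s0 t0 a0 b0; have st0 : 0 < s + t by rewrite addr_gt0.
have e1 : 1 - s / (s + t) = t / (s + t) by field; rewrite gt_eqF.
have -> : a + b = (s + t)
  * (s / (s + t) * (a / s) + (1 - s / (s + t)) * (b / t)).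
  by field; rewrite !gt_eqF.
have as0 : 0 <= a / s by rewrite divr_ge0// ltW.
have bt0 : 0 <= b / t by rewrite divr_ge0// ltW.
rewrite powRM; last 2 first.
- exact: ltW.
- by rewrite e1 addr_ge0// mulr_ge0// divr_ge0// ltW.
apply: ler_wpM2l; first exact: powR_ge0.
have dE x y : 0 <= x -> 0 < y -> x `^ q / y `^ q = (x / y) `^ q.
  move=> x0 y0; rewrite powRM// ?invr_ge0 ?(ltW y0)//; congr (_ * _).
  have yq0 : y `^ q != 0 by rewrite powR_eq0 gt_eqF.
  by apply: (mulfI yq0);
    rewrite divff// -powRM ?invr_ge0 ?(ltW y0)// divff ?gt_eqF// powR1.
rewrite !dE// -e1; apply: convex => //.
by rewrite divr_ge0 ?(ltW s0) ?(ltW st0)//= ler_pdivrMr// mul1r lerDl ltW.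
Qed.

Let sum_eq0 a1 a2 a3 : w1 * a1 `^ q + w2 * a2 `^ q + w3 * a3 `^ q = 0 ->
  [/\ w1 = 0 \/ a1 = 0, w2 = 0 \/ a2 = 0 & w3 = 0 \/ a3 = 0].
Proof.
have h w a : w * a `^ q = 0 -> w = 0 \/ a = 0.
  move=> /eqP; rewrite mulf_eq0 => /orP[/eqP|/eqP/powR_eq0_eq0];
    by [left|right].
have g w a : 0 <= w -> 0 <= w * a `^ q by move=> ?; rewrite mulr_ge0// powR_ge0.
have := g _ a1 w1_ge0; have := g _ a2 w2_ge0; have := g _ a3 w3_ge0.
by move=> *; split; apply: h; lra.
Qed.

Lemma le_weighted_norm a1 a2 a3 b1 b2 b3 :
  0 <= a1 <= b1 -> 0 <= a2 <= b2 -> 0 <= a3 <= b3 ->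
  weighted_norm a1 a2 a3 <= weighted_norm b1 b2 b3.
Proof.
have h w a b : 0 <= w -> 0 <= a <= b -> w * a `^ q <= w * b `^ q.
  move=> w0 /andP[a0 ab]; apply: ler_wpM2l => //.
  by apply: ge0_ler_powR; rewrite ?nnegrE ?(ltW q0) ?(le_trans a0 ab).
move=> h1 h2 h3; apply: ge0_ler_powR; rewrite ?nnegrE ?invr_ge0 ?(ltW q0)//.
by rewrite !lerD// h.
Qed.

Let cancel0 w a b : w = 0 \/ a = 0 -> w * (a + b) `^ q = w * b `^ q.
Proof. by move=> [->|->]; rewrite ?mul0r ?add0r. Qed.

(** Minkowski's inequality: [convex_scaled] with [s] and [t] the two norms,
    summed over the three terms.  A norm is zero exactly when each term has
    zero weight or zero entry, and the inequality is then an equality. *)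
Lemma weighted_normD a1 a2 a3 b1 b2 b3 : 0 <= a1 -> 0 <= a2 -> 0 <= a3 ->
  0 <= b1 -> 0 <= b2 -> 0 <= b3 ->
  weighted_norm (a1 + b1) (a2 + b2) (a3 + b3) <=
  weighted_norm a1 a2 a3 + weighted_norm b1 b2 b3.
Proof.
move=> a10 a20 a30 b10 b20 b30.
rewrite /weighted_norm; set A := w1 * a1 `^ q + _ + _.
set B := w1 * b1 `^ q + _ + _.
have A0 : 0 <= A by exact: sum_ge0.
have B0 : 0 <= B by exact: sum_ge0.
have [Az|An] := eqVneq A 0.
  have [h1 h2 h3] := sum_eq0 Az.
  by rewrite !cancel0// -/B Az powR0 ?invr_neq0// add0r.
have [Bz|Bn] := eqVneq B 0.
  have [h1 h2 h3] := sum_eq0 Bz.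
  rewrite (addrC a1) (addrC a2) (addrC a3) !cancel0// -/A Bz.
  by rewrite powR0 ?invr_neq0// addr0.
have s0 : 0 < A `^ q^-1 by rewrite powR_gt0// lt_def An.
have t0 : 0 < B `^ q^-1 by rewrite powR_gt0// lt_def Bn.
have sq : (A `^ q^-1) `^ q = A by exact: powRK.
have tq : (B `^ q^-1) `^ q = B by exact: powRK.
move: (A `^ q^-1) (B `^ q^-1) s0 t0 sq tq => s t s0 t0 sq tq.
apply: root_le; [exact: sum_ge0|by rewrite addr_ge0// ltW|].
have h a b w : 0 <= w -> 0 <= a -> 0 <= b -> w * (a + b) `^ q <=
  (s + t) `^ q * (s / (s + t) / A * (w * a `^ q) + t / (s + t)
    / B * (w * b `^ q)).
  move=> w0 a0 b0; have := ler_wpM2l w0 (convex_scaled s0 t0 a0 b0).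
  rewrite sq tq => /le_trans; apply; rewrite le_eqVlt; apply/orP; left;
    apply/eqP.
  by field; rewrite An Bn gt_eqF// addr_gt0.
apply: le_trans (lerD (lerD (h _ _ _ w1_ge0 a10 b10) (h _ _ _ w2_ge0 a20 b20))
  (h _ _ _ w3_ge0 a30 b30)) _.
rewrite le_eqVlt; apply/orP; left; apply/eqP.
rewrite -!mulrDr.
transitivity ((s + t) `^ q * (s / (s + t) / A * A + t / (s + t) / B * B)).
  by rewrite /A /B; ring.
have -> : s / (s + t) / A * A + t / (s + t) / B * B = 1.
  by field; rewrite An Bn gt_eqF// addr_gt0.
by rewrite mulr1.
Qed.

Lemma weighted_norm_ge a1 a2 a3 :
  0 <= a1 -> 0 <= a2 -> 0 <= a3 ->
  [/\ w1 `^ q^-1 * a1 <= weighted_norm a1 a2 a3,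
      w2 `^ q^-1 * a2 <= weighted_norm a1 a2 a3 &
      w3 `^ q^-1 * a3 <= weighted_norm a1 a2 a3].
Proof.
move=> a10 a20 a30.
have g w a : 0 <= w -> 0 <= w * a `^ q by move=> ?; rewrite mulr_ge0// powR_ge0.
have g1 := g _ a1 w1_ge0; have g2 := g _ a2 w2_ge0; have g3 := g _ a3 w3_ge0.
have h w a : 0 <= w -> 0 <= a -> w `^ q^-1 * a = (w * a `^ q) `^ q^-1.
  by move=> w0 a0; rewrite powRM ?powR_ge0// -powRrM divff// powRr1.
by split; rewrite h//; apply: ge0_ler_powR;
  rewrite ?nnegrE ?invr_ge0 ?(ltW q0) ?g//; lra.
Qed.

End WeightedPowerMean.

(** * Functions with values in a separable metric space *)
Section SeparableMetric.
Context {R : realType} (S : metricType R).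
Hypothesis separableS : separable_space S.

Lemma dense_sequence (s0 : S) : exists s_ : nat -> S,
  forall x (e : R), 0 < e -> exists n, mdist (s_ n) x < e.
Proof.
have [t_ ht] := separable_dense_sequence s0 separableS.
exists t_ => x e e0; have [||n xn] := ht (interior (ball x e)).
- exact: open_interior.
- by exists x; exact: nbhsx_ballx.
exists n; rewrite metric_sym.
by have := interior_subset xn; rewrite ballEmdist.
Qed.

(** The measurability clause of [in_Lp]. *)
Definition borel_fun d (W : measurableType d) (f : W -> S) : Prop :=
  forall B : set S, <<s @open S >> B -> measurable (f @^-1` B).

Lemma borel_fun_cst d (W : measurableType d) (s : S) :
  borel_fun (fun _ : W => s).
Proof.
move=> B _; have [Bs|nBs] := pselect (B s).
  by rewrite (_ : _ @^-1` _ = setT)//; apply/seteqP; split.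
by rewrite (_ : _ @^-1` _ = set0)//; apply/seteqP; split.
Qed.

Lemma borel_fun_comp d d' (W : measurableType d) (V : measurableType d')
    (f : V -> S) (g : W -> V) :
  measurable_fun setT g -> borel_fun f -> borel_fun (f \o g).
Proof.
move=> mg bf B sB; rewrite comp_preimage.
by apply: (preimage_measurable mg); exact: bf.
Qed.

Lemma open_mdist (s : S) (r : R) : open [set x | mdist x s < r].
Proof.
rewrite openE => y /= ys; rewrite /interior.
have e0 : 0 < r - mdist y s by rewrite subr_gt0.
apply: filterS (nbhsx_ballx y _ e0) => z; rewrite ballEmdist/= => yz.
by rewrite (le_lt_trans (metric_triangle z y s))// metric_sym -ltrBrDr.
Qed.

(** Separability is essential: the distance is below r exactly when some point
    of a dense sequence is at total distance below r from both points, which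
    avoids the product of two Borel sigma-algebras. *)
Lemma measurable_mdist d (W : measurableType d) (f g : W -> S) :
  borel_fun f -> borel_fun g ->
  measurable_fun [set: W] (fun w => mdist (f w) (g w)).
Proof.
move=> bf bg; have [s_ s_dense] := dense_sequence (f point).
have mball h s : borel_fun h ->
    measurable_fun [set: W] (fun w => mdist (h w) s).
  move=> bh; apply: (measurability _ (RGenInftyO.measurableE R)) => //.
  move=> _ [_ [r ->] <-]; rewrite setTI.
  rewrite (_ : _ @^-1` _ = h @^-1` [set x | mdist x s < r]).
    by apply: bh; apply: sub_sigma_algebra; exact: open_mdist.
  by apply/seteqP; split => w /=; rewrite in_itv.
apply: (measurability _ (RGenInftyO.measurableE R)) => //.
move=> _ [_ [r ->] <-]; rewrite setTI.
rewrite (_ : _ @^-1` _ =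
    \bigcup_n [set w | mdist (f w) (s_ n) + mdist (g w) (s_ n) < r]).
  apply: bigcupT_measurable => n.
  apply: measurable_ltr_set => //.
  by apply: measurable_funD; exact: mball.
apply/seteqP; split => w /=; rewrite in_itv/=.
  move=> fg; have e0 : 0 < (r - mdist (f w) (g w)) / 2.
    by rewrite divr_gt0// subr_gt0.
  have [n hn] := s_dense (f w) _ e0; exists n => //=.
  have := metric_triangle (g w) (f w) (s_ n).
  rewrite (metric_sym (g w) (f w)) (metric_sym (f w) (s_ n)); lra.
move=> [n _ /= h]; apply: le_lt_trans h.
by rewrite (metric_sym (g w)); exact: metric_triangle.
Qed.

(** Around a point of a dense sequence close to [a], a ball contains [a] while
    [b] lies outside the ball of twice the radius; the pairs (n, k) being
    countable, the complement of the diagonal is a countable union of products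
    of sets at positive distance. *)
Lemma separating_balls (s0 : S) : exists (s_ : nat -> S) (r : nat -> R),
  (forall k, 0 < r k) /\
  forall a b, a <> b -> exists n k,
    mdist a (s_ n) < r k /\ 2 * r k < mdist b (s_ n).
Proof.
have [s_ s_dense] := dense_sequence s0.
exists s_, (fun k => k.+1%:R^-1); split=> [k|a b ab]; first by rewrite invr_gt0.
have d0 : 0 < mdist a b / 3 by rewrite divr_gt0// mdist_gt0; apply/eqP.
have [k _ /(_ _ (leqnn _)) hk] := near_infty_natSinv_lt (PosNum d0).
have r0 : 0 < (k.+1%:R^-1 : R) by rewrite invr_gt0.
have [n hn] := s_dense a _ r0; exists n, k.
rewrite (metric_sym a); split => //.
have := metric_triangle a (s_ n) b;
  rewrite (metric_sym a (s_ n)) (metric_sym (s_ n) b).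
by move: hk hn; rewrite /=; move: (k.+1%:R^-1 : R) => r; lra.
Qed.

End SeparableMetric.

(** * Distortion of a coupling *)
Section Distortion.
Context {R : realType} d1 d2 (X : measurableType d1) (Y : measurableType d2).
Variables (mu : probability X R) (nu : probability Y R).
Variable (S : metricType R).
Hypothesis separableS : separable_space S.
Variables (f : X * X -> S) (g : Y * Y -> S).

Definition distortion (z : (X * Y) * (X * Y)) : R :=
  mdist (f (z.1.1, z.2.1)) (g (z.1.2, z.2.2)).

Lemma distortion_ge0 z : 0 <= distortion z.
Proof. exact: mdist_ge0. Qed.

Hypotheses (bf : borel_fun f) (bg : borel_fun g).

Lemma measurable_distortion : measurable_fun setT distortion.
Proof.
apply: (measurable_mdist separableS (f := f \o square_map fst)
  (g := g \o square_map snd)).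
- apply: borel_fun_comp => //; exact: measurable_square_map.
- apply: borel_fun_comp => //; exact: measurable_square_map.
Qed.

(** On the box of points with f(x, x') near s_n and g(y, y') away from it, the
    cost is at least c r_k, so that the mass of the box under pi_m x pi_m is at
    most 1 / ((m + 1) c r_k) by Chebyshev's inequality.  The limit coupling does
    not charge these boxes, and they cover the set where f and g disagree. *)
Lemma distortion_ae0 (pi_ : nat -> probability (X * Y)%type R)
    (pi : probability (X * Y)%type R)
    (cost : (X * Y) * (X * Y) -> R) (c : R) (p : \bar R) : (1 <= p)%E ->
  (forall P Q, measurable P -> measurable Q ->
      fine ((pi_ n \x pi_ n)%E (box P Q)) @[n --> \oo] --> (0 : R) ->
      (pi \x pi)%E (box P Q) = 0%E) ->
  measurable_fun setT cost -> 0 < c ->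
  (forall z, c * distortion z <= cost z) ->
  (forall n, 'N[(pi_ n \x pi_ n)%E]_p[EFin \o cost] < (n.+1%:R^-1)%:E)%E ->
  \forall z \ae (pi \x pi)%E, f (z.1.1, z.2.1) = g (z.1.2, z.2.2).
Proof.
move=> p1 hbox mcost c0 ccost hN.
have [s_ [r [r0 hr]]] := separating_balls separableS (f point).
pose P n k := [set x | mdist (f x) (s_ n) < r k].
pose Q n k := [set y | 2 * r k < mdist (g y) (s_ n)].
have mP n k : measurable (P n k).
  apply: measurable_ltr_set => //.
  exact: (measurable_mdist separableS bf (borel_fun_cst _ (s_ n))).
have mQ n k : measurable (Q n k).
  apply: measurable_ltr_set => //.
  exact: (measurable_mdist separableS bg (borel_fun_cst _ (s_ n))).
have cost0 z : 0 <= cost z.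
  by apply: le_trans (ccost z); rewrite mulr_ge0 ?distortion_ge0 ?ltW.
have box0 n k : (pi \x pi)%E (box (P n k) (Q n k)) = 0%E.
  apply: hbox => //; have cr0 : 0 < c * r k by rewrite mulr_gt0.
  have mbox := measurable_box (mP n k) (mQ n k).
  have cbox z : box (P n k) (Q n k) z -> c * r k <= cost z.
    move=> [/= Pz Qz]; apply: le_trans (ccost z); rewrite ler_pM2l//.
    have := metric_triangle (g (z.1.2, z.2.2)) (f (z.1.1, z.2.1)) (s_ n).
    rewrite (metric_sym (g _) (f _)).
    by move: Pz Qz; rewrite /P /Q /distortion /=; lra.
  apply/cvgrPdist_lt => e e0.
  have ce0 : 0 < c * r k * e by rewrite mulr_gt0.
  have := near_infty_natSinv_lt (PosNum ce0); apply: filterS => m /= hm.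
  pose pim : probability ((X * Y) * (X * Y))%type R := (pi_ m \x pi_ m)%E.
  have := Lnorm_ge_measure pim p1 mcost mbox (ltW cr0) cost0 cbox.
  move=> /le_lt_trans => /(_ _ (hN m)) h.
  have fbox : pim (box (P n k) (Q n k)) \is a fin_num by exact: fin_num_measure.
  rewrite sub0r normrN ger0_norm ?fine_ge0//.
  rewrite -(ltr_pM2l cr0); apply: lt_trans hm.
  by rewrite -lte_fin EFinM [X in (_ * X)%E]fineK.
have neg : (pi \x pi)%E.-negligible (\bigcup_n \bigcup_k box (P n k) (Q n k)).
  apply: negligible_bigcup => n; apply: negligible_bigcup => k.
  exists (box (P n k) (Q n k)).
  by split; [exact: measurable_box|exact: box0|].
apply: negligibleS neg => z /= fg.
have [n [k [h1 h2]]] := hr _ _ fg.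
by exists n => //; exists k.
Qed.

(** The distortion is at most d(f, s) + d(g, t) + d(s, t), and the laws of
    (x, x') and (y, y') under pi x pi do not depend on pi. *)
Lemma distortion_Lp_lty (p : \bar R) (pi : probability (X * Y)%type R) :
  (1 <= p)%E -> image_law pi fst mu -> image_law pi snd nu ->
  in_Lp (mu \x mu)%E p f -> in_Lp (nu \x nu)%E p g ->
  ('N[(pi \x pi)%E]_p[EFin \o distortion] < +oo)%E.
Proof.
move=> p1 pimu pinu [_ [s fs]] [_ [t gt]].
pose pi2 : probability ((X * Y) * (X * Y))%type R := (pi \x pi)%E.
have m1 := measurable_square_map
  (measurable_fst : measurable_fun setT (@fst X Y)).
have m2 := measurable_square_map
  (measurable_snd : measurable_fun setT (@snd X Y)).
have mf : measurable_fun [set: X * X] (fun w => mdist (f w) s).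
  by apply: (measurable_mdist separableS) => //; exact: borel_fun_cst.
have mg : measurable_fun [set: Y * Y] (fun w => mdist (g w) t).
  by apply: (measurable_mdist separableS) => //; exact: borel_fun_cst.
have hf : ('N[pi2]_p[EFin \o (fun z => mdist (f (square_map fst z)) s)] <
  +oo)%E.
  have := Lnorm_image_law (g := fun w => (mdist (f w) s)%:E) m1
    (image_law_square measurable_fst pimu) _ p1.
  move=> <-//; exact/measurable_EFinP.
have hg : ('N[pi2]_p[EFin \o (fun z => mdist (g (square_map snd z)) t)] <
  +oo)%E.
  have := Lnorm_image_law (g := fun w => (mdist (g w) t)%:E) m2
    (image_law_square measurable_snd pinu) _ p1.
  move=> <-//; exact/measurable_EFinP.
have mf' : measurable_fun setT
    (fun z : (X * Y) * (X * Y) => mdist (f (square_map fst z)) s).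
  exact: (measurableT_comp mf m1).
have mg' : measurable_fun setT
    (fun z : (X * Y) * (X * Y) => mdist (g (square_map snd z)) t).
  exact: (measurableT_comp mg m2).
have hfg := Lnorm_addr_lty p1 (P := pi2) mf' mg' hf hg.
have mfg := measurable_funD mf' mg'.
have hc := Lnorm_cst_lty pi2 p1 (mdist s t).
have := Lnorm_addr_lty p1 (P := pi2) mfg (measurable_cst _) hfg hc.
apply: le_lt_trans; apply: le_Lnorm => //.
- exact: measurable_distortion.
- exact: measurable_funD.
- move=> z; rewrite distortion_ge0/= /distortion.
  have := metric_triangle (f (square_map fst z)) s (g (square_map snd z)).
  have := metric_triangle s t (g (square_map snd z)).
  rewrite (metric_sym t); rewrite /square_map; lra.
Qed.

End Distortion.

(** * Laws on the real line *)
Section RealLine.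
Variable R : realType.

Lemma separable_real : separable_space R^o.
Proof.
exists (range ratr); last exact: dense_rat.
by apply: (sub_countable (card_image_le _ _)); exact: countableP.
Qed.

Lemma polish_real : polish R R^o.
Proof.
split; first exact: separable_real.
exists (R^o : metricType R), id, id; split => //.
- by move=> x; exact: cvg_id.
- by move=> x; exact: cvg_id.
- move=> F FF cF; exists (lim F); exact: cauchy_cvg.
Qed.

(** The sigma-algebra of the real line is presented by intervals on one side and
    by open sets on the other. *)
Lemma measurable_from_borel_real d (T : measurableType d) (f : R -> T) :
  measurable_fun [set: R] f ->
  measurable_fun [set: borel R^o] (f : borel R^o -> T).
Proof.
move=> mf _ A mA; have := preimage_measurable mf mA.
rewrite setTI; move: (_ @^-1` _) => B.
rewrite [X in X _ -> _](RGenOpens.measurableE R); apply: smallest_sub.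
  exact: smallest_sigma_algebra.
move=> _ [x [y ->]]; apply: sub_sigma_algebra.
exact: interval_open.
Qed.

(** The line is a Polish space on which every law of a bit-codable space can be
    carried, by the retraction onto its code. *)
Lemma bit_codable_law d (T : measurableType d) (pi : probability T R) :
  bit_codable T -> exists (W : polish_probability_space R) (rho : borel W -> T),
    measurable_fun setT rho /\ image_law (pp_mu W) rho pi.
Proof.
move=> /(@bit_codable_retract R)[i [j [mi mj ij]]].
have mj' := measurable_from_borel_real mj.
have mi' : measurable_fun [set: T] (i : T -> borel R^o).
  by apply: measurable_to_borel => V oV; apply: (preimage_measurable mi);
    exact: open_measurable.
have [lam lamE] := image_law_exists pi mi'.
exists (PolishProbabilitySpace polish_real lam), j; split; first exact: mj'.
move=> A mA; rewrite /pushforward/= -lamE.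
  by rewrite /pushforward; congr (pi _); apply/seteqP; split => x /=;
    rewrite ij.
exact: (preimage_measurable mj').
Qed.

End RealLine.

(** * The metric on networks *)
Section Networks.
Context {R : realType} {p : \bar R} {Omega Psi : metricType R}.
Hypotheses (hOmega : separable_space Omega) (hPsi : separable_space Psi).
Hypothesis p1 : (1 <= p)%E.
Variables (q alpha beta : R).
Hypotheses (q1 : 1 <= q) (alpha0 : 0 <= alpha) (beta0 : 0 <= beta).
Hypothesis ab1 : alpha + beta <= 1.
Implicit Types X Y Z : Hnetwork p Omega Psi.

Let gamma := 1 - alpha - beta.
Let gamma0 : 0 <= gamma. Proof. by rewrite /gamma; move: ab1; lra. Qed.

(** Seen as a function of pairs, psi is treated exactly like omega and phi. *)
Definition psi_fst X : (borel X * borel X)%type -> Psi :=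
  @psi_ _ _ _ _ X \o fst.

Local Notation cost X Y := (@FNGW_cost R p Omega Psi q alpha beta X Y).
Local Notation dpsi X Y := (distortion (@psi_fst X) (@psi_fst Y)).
Local Notation domega X
  Y := (distortion (@omega_ _ _ _ _ X) (@omega_ _ _ _ _ Y)).
Local Notation dphi X Y := (distortion (@phi_ _ _ _ _ X) (@phi_ _ _ _ _ Y)).

Lemma FNGW_costE X Y z : cost X Y z =
  weighted_norm q gamma alpha beta (dpsi X Y z) (domega X Y z) (dphi X Y z).
Proof. by rewrite /FNGW_cost /weighted_norm /distortion distrC. Qed.

Lemma FNGW_cost_ge0 X Y z : 0 <= cost X Y z.
Proof. exact: powR_ge0. Qed.

Let bpsi X : borel_fun (@psi_fst X).
Proof. by apply: borel_fun_comp => //; case: (psi_Lp X). Qed.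
Let bomega X : borel_fun (@omega_ _ _ _ _ X).
Proof. by case: (omega_Lp X). Qed.
Let bphi X : borel_fun (@phi_ _ _ _ _ X).
Proof. by case: (phi_Lp X). Qed.

Let mpsi X Y := measurable_distortion hPsi (@bpsi X) (@bpsi Y).
Let momega X Y := measurable_distortion hOmega (@bomega X) (@bomega Y).
Let mphi X Y := measurable_distortion (@separable_real R) (@bphi X) (@bphi Y).

Lemma measurable_FNGW_cost X Y : measurable_fun setT (cost X Y).
Proof.
rewrite (_ : cost X Y = fun z => weighted_norm q gamma alpha beta
  (dpsi X Y z) (domega X Y z) (dphi X Y z)); last first.
  by apply/funext => z; exact: FNGW_costE.
have mpow (r : R) (h : (borel X * borel Y) * (borel X * borel Y) -> R) :
    measurable_fun setT h -> measurable_fun setT (fun z => h z `^ r).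
  exact: (measurableT_comp (measurable_powR r)).
apply: (mpow); apply: measurable_funD; first apply: measurable_funD.
- by apply: measurable_funM => //; apply: (mpow); exact: mpsi.
- by apply: measurable_funM => //; apply: (mpow); exact: momega.
- by apply: measurable_funM => //; apply: (mpow); exact: mphi.
Qed.

Lemma product_coupling X Y : couplings X Y (pp_mu X \x pp_mu Y)%E.
Proof.
split => A mA; first exact: product_probability_fst.
rewrite /pushforward (_ : snd @^-1` A = setT `*` A).
  by rewrite -[RHS]mul1e -(probability_setT (pp_mu X));
    exact: product_measure1E.
by apply/seteqP; split => -[x y] //= [].
Qed.

Let psi_fst_Lp X : in_Lp (pp_mu X \x pp_mu X)%E p (@psi_fst X).
Proof.
split; first exact: bpsi.
have [bX [s sX]] := psi_Lp X; exists s.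
pose XX : probability (borel X * borel X)%type R := (pp_mu X \x pp_mu X)%E.
have XXfst : image_law XX fst (pp_mu X).
  by move=> A mA; exact: product_probability_fst.
have := Lnorm_image_law (g := fun w => (mdist (psi_ w) s)%:E)
  measurable_fst XXfst _ p1.
move=> <-//; apply/measurable_EFinP.
apply: (measurable_mdist hPsi bX); exact: borel_fun_cst.
Qed.

Lemma FNGW_cost_Lp_lty X Y (pi : probability (borel X * borel Y)%type R) :
  couplings X Y pi -> ('N[(pi \x pi)%E]_p[EFin \o cost X Y] < +oo)%E.
Proof.
move=> [piX piY].
pose pi2 : probability ((borel X * borel Y) * (borel X * borel Y))%type R :=
  (pi \x pi)%E.
have h1 := distortion_Lp_lty hPsi (@bpsi X) (@bpsi Y) p1 piX piY
  (psi_fst_Lp X) (psi_fst_Lp Y).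
have h2 := distortion_Lp_lty hOmega (@bomega X) (@bomega Y) p1 piX piY
  (omega_Lp X) (omega_Lp Y).
have h3 := distortion_Lp_lty (@separable_real R) (@bphi X) (@bphi Y) p1 piX piY
  (phi_Lp X) (phi_Lp Y).
have h12 := Lnorm_addr_lty (P := pi2) p1 (@mpsi X Y) (@momega X Y) h1 h2.
have m12 := measurable_funD (@mpsi X Y) (@momega X Y).
have := Lnorm_addr_lty (P := pi2) p1 m12 (@mphi X Y) h12 h3.
apply: le_lt_trans; apply: (@le_Lnorm _ _ _ pi2 _ p1).
- exact: measurable_FNGW_cost.
- exact: (measurable_funD m12 (@mphi X Y)).
- move=> z; rewrite FNGW_cost_ge0/= FNGW_costE.
  by apply: weighted_norm_le_sum => //; rewrite ?distortion_ge0// /gamma; lra.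
Qed.

Local Notation norms X Y := [set 'N[(pi \x pi)%E]_p[EFin \o cost X Y]%E
  | pi in couplings X Y].

Let inf_ge0 X Y : (0 <= ereal_inf (norms X Y))%E.
Proof. by apply: le_ereal_inf_tmp => _ [pi _ <-]; exact: Lnorm_ge0. Qed.

Let inf_fin X Y : ereal_inf (norms X Y) \is a fin_num.
Proof.
rewrite ge0_fin_numE//.
apply: le_lt_trans (FNGW_cost_Lp_lty (product_coupling X Y)).
by apply: ereal_inf_lbound; exists (pp_mu X \x pp_mu Y)%E => //;
  exact: product_coupling.
Qed.

Let inf_sym X Y : (ereal_inf (norms X Y) <= ereal_inf (norms Y X))%E.
Proof.
apply: le_ereal_inf_tmp => _ [pi [piY piX] <-].
pose s (w : (borel Y * borel X)%type) : (borel X * borel Y)%type := (w.2, w.1).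
have ms : measurable_fun setT s by exact: measurable_fun_pair.
have [pi' pi'E] := image_law_exists pi ms.
apply: ereal_inf_lbound; exists pi'.
  split.
  - exact: (image_law_factor measurable_fst pi'E piX).
  - exact: (image_law_factor measurable_snd pi'E piY).
have mcost : measurable_fun setT (EFin \o cost X Y).
  by apply/measurable_EFinP; exact: measurable_FNGW_cost.
rewrite (Lnorm_image_law (measurable_square_map ms) (image_law_square ms pi'E)
  mcost p1).
have cost_sym : (EFin \o cost X Y) \o square_map s = EFin \o cost Y X.
  apply/funext => z; rewrite /comp !FNGW_costE;
    congr (weighted_norm _ _ _ _ _ _ _)%:E;
  exact: metric_sym.
by rewrite cost_sym.
Qed.

(** On the glued space the three costs are functions of the same variable, so
    that the pointwise triangle inequality and Minkowski's inequality apply. *)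
Let inf_triangle X Y Z :
  (ereal_inf (norms X Z) <= ereal_inf (norms X Y) + ereal_inf (norms Y Z))%E.
Proof.
suff h u v : norms X Y u -> norms Y Z v -> (ereal_inf (norms X Z) <= u + v)%E.
  apply/lee_addgt0Pr => e e0; have e2 : 0 < e / 2 by rewrite divr_gt0.
  have [u Su ule] := lb_ereal_inf_adherent e2 (inf_fin X Y).
  have [v Sv vle] := lb_ereal_inf_adherent e2 (inf_fin Y Z).
  apply: le_trans (h _ _ Su Sv) _; rewrite (splitr e) EFinD addeACA.
  by apply: leeD; exact: ltW.
move=> [pi1 [pi1X pi1Y] <-] [pi2 [pi2Y pi2Z] <-].
have [lam lamE] := uniform01_exists R.
have bZ := polish_bit_codable (pp_polish Z).
have [P [h [mh Pa Pb]]] := gluing lamE bZ pi1Y pi2Y pi2Z.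
pose b (w : ((borel X * borel Y) * R)%type) : (borel Y * borel Z)%type :=
  (w.1.2, h w).
pose c (w : ((borel X * borel Y) * R)%type) : (borel X * borel Z)%type :=
  (w.1.1, h w).
have mb : measurable_fun setT b.
  apply: measurable_fun_pair => //.
  exact: (measurableT_comp measurable_snd measurable_fst).
have mc : measurable_fun setT c.
  apply: measurable_fun_pair => //.
  exact: (measurableT_comp measurable_fst measurable_fst).
have [pi3 Pc] := image_law_exists P mc.
have pi3XZ : couplings X Z pi3.
  split.
  - apply: (image_law_factor measurable_fst Pc).
    exact: (image_law_comp measurable_fst Pa pi1X).
  - apply: (image_law_factor measurable_snd Pc).
    exact: (image_law_comp measurable_snd Pb pi2Z).
apply: (@le_trans _ _ 'N[(pi3 \x pi3)%E]_p[EFin \o cost X Z]%E).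
  by apply: ereal_inf_lbound; exists pi3.
have mfst : measurable_fun setT (@fst (borel X * borel Y)%type R)
  by exact: measurable_fst.
have mcost X' Y' : measurable_fun setT (EFin \o cost X' Y').
  by apply/measurable_EFinP; exact: measurable_FNGW_cost.
rewrite (Lnorm_image_law (measurable_square_map mc) (image_law_square mc Pc)
  (mcost X Z) p1).
rewrite (Lnorm_image_law (measurable_square_map mb) (image_law_square mb Pb)
  (mcost Y Z) p1).
rewrite (Lnorm_image_law (measurable_square_map mfst) (image_law_square mfst Pa)
  (mcost X Y) p1).
have m1 := measurableT_comp (@measurable_FNGW_cost X Y)
  (measurable_square_map mfst).
have m2 := measurableT_comp (@measurable_FNGW_cost Y Z)
  (measurable_square_map mb).
have m3 := measurableT_comp (@measurable_FNGW_cost X Z)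
  (measurable_square_map mc).
pose PP : probability
  (((borel X * borel Y) * R) * ((borel X * borel Y) * R))%type R := (P \x P)%E.
apply: le_trans (eminkowski PP m1 m2 p1).
apply: (@le_Lnorm _ _ _ PP _ p1 _ _ m3 (measurable_funD m1 m2)).
move=> z /=; rewrite FNGW_cost_ge0/= !FNGW_costE.
have d_ge0 := @distortion_ge0 R.
apply: le_trans (weighted_normD q1 gamma0 alpha0 beta0 (d_ge0 _ _ _ _ _ _ _ _)
  (d_ge0 _ _ _ _ _ _ _ _) (d_ge0 _ _ _ _ _ _ _ _) (d_ge0 _ _ _ _ _ _ _ _)
  (d_ge0 _ _ _ _ _ _ _ _) (d_ge0 _ _ _ _ _ _ _ _)).
by apply: le_weighted_norm => //; rewrite distortion_ge0/=;
  exact: metric_triangle.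
Qed.

Lemma weakly_isomorphic_inf0 X Y : weakly_isomorphic alpha beta X Y ->
  ereal_inf (norms X Y) = 0%E.
Proof.
move=> [W [rX [rY [mX mY lX lY iso]]]]; apply/eqP; rewrite eq_le inf_ge0 andbT.
pose r (w : borel W) : (borel X * borel Y)%type := (rX w, rY w).
have mr : measurable_fun setT r by exact: measurable_fun_pair.
have [pi piE] := image_law_exists (pp_mu W) mr.
have piXY : couplings X Y pi.
  split.
  - exact: (image_law_factor measurable_fst piE lX).
  - exact: (image_law_factor measurable_snd piE lY).
have mcost : measurable_fun setT (EFin \o cost X Y).
  by apply/measurable_EFinP; exact: measurable_FNGW_cost.
have mcostr := measurableT_comp (@measurable_FNGW_cost X Y)
  (measurable_square_map mr).
have cost0 : \forall w \ae (pp_mu W \x pp_mu W)%E,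
  (cost X Y \o square_map r) w = 0.
  apply: filterS iso => -[w w'] /= [hpsi homega hphi].
  rewrite FNGW_costE /distortion /psi_fst /=.
  rewrite /weighted_norm.
  have z0 (g x : R) : 0 <= g -> (0 < g -> x = 0) -> g * x `^ q = 0.
    rewrite le_eqVlt => /predU1P[<-|g0 /(_ g0) ->]; first by rewrite mul0r.
    by rewrite powR0 ?mulr0// gt_eqF// (lt_le_trans _ q1).
  rewrite !z0 ?addr0 ?powR0 ?invr_neq0 ?gt_eqF ?(lt_le_trans _ q1)// => h.
  - by rewrite hphi// mdistxx.
  - by rewrite homega// mdistxx.
  - by rewrite hpsi// mdistxx.
pose WW : probability (borel W * borel W)%type R := (pp_mu W \x pp_mu W)%E.
have N0 := @Lnorm_ae0 _ _ _ WW _ p1 _ mcostr cost0.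
have N1 := Lnorm_image_law (measurable_square_map mr) (image_law_square mr piE)
  mcost p1.
apply: ereal_inf_lbound; exists pi; first exact: piXY.
exact: (etrans N1 N0).
Qed.

(** The limit coupling has cost 0, and a coupling of cost 0 is a weak
    isomorphism with (rhoX, rhoY) the identity of X x Y; the definition asks
    for a Polish space W, and the line is used in place of X x Y. *)
Lemma inf0_weakly_isomorphic X Y : ereal_inf (norms X Y) = 0%E ->
  weakly_isomorphic alpha beta X Y.
Proof.
move=> inf0.
have /choice[pi_ pi_P] n : exists pi, couplings X Y pi /\
    ('N[(pi \x pi)%E]_p[EFin \o cost X Y] < (n.+1%:R^-1)%:E)%E.
  have : (ereal_inf (norms X Y) < (n.+1%:R^-1)%:E)%E.
    by rewrite inf0 lte_fin invr_gt0.
  by move=> /ereal_inf_lt[_ [pi piXY <-] h]; exists pi.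
have bX := polish_bit_codable (pp_polish X).
have bY := polish_bit_codable (pp_polish Y).
have [|pi [piX piY pi0]] :=
  @limit_coupling R _ _ _ _ (pp_mu X) (pp_mu Y) pi_ bY.
  by move=> n; exact: (pi_P n).1.
have mcost := @measurable_FNGW_cost X Y.
have hN n := (pi_P n).2.
have costge z := weighted_norm_ge q1 gamma0 alpha0 beta0
  (@distortion_ge0 _ _ _ _ _ _ (@psi_fst X) (@psi_fst Y) z)
  (@distortion_ge0 _ _ _ _ _ _ (@omega_ _ _ _ _ X) (@omega_ _ _ _ _ Y) z)
  (@distortion_ge0 _ _ _ _ _ _ (@phi_ _ _ _ _ X) (@phi_ _ _ _ _ Y) z).
have aepsi : \forall z \ae (pi \x pi)%E,
    0 < gamma -> psi_ z.1.1 = psi_ z.1.2.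
  have [g0|_] := ltP 0 gamma; last exact: nearW.
  have := distortion_ae0 hPsi (@bpsi X) (@bpsi Y)
    p1 pi0 mcost (powR_gt0 q^-1 g0) _ hN.
  move=> /(_ _)/filterS; apply => //.
  by move=> z; rewrite FNGW_costE; case: (costge z).
have aeomega : \forall z \ae (pi \x pi)%E,
    0 < alpha -> omega_ (z.1.1, z.2.1) = omega_ (z.1.2, z.2.2).
  have [g0|_] := ltP 0 alpha; last exact: nearW.
  have := distortion_ae0 hOmega (@bomega X) (@bomega Y)
    p1 pi0 mcost (powR_gt0 q^-1 g0) _ hN.
  move=> /(_ _)/filterS; apply => //.
  by move=> z; rewrite FNGW_costE; case: (costge z).
have aephi : \forall z \ae (pi \x pi)%E,
    0 < beta -> phi_ (z.1.1, z.2.1) = phi_ (z.1.2, z.2.2).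
  have [g0|_] := ltP 0 beta; last exact: nearW.
  have := distortion_ae0 (@separable_real R) (@bphi X) (@bphi Y)
    p1 pi0 mcost (powR_gt0 q^-1 g0) _ hN.
  move=> /(_ _)/filterS; apply => //.
  by move=> z; rewrite FNGW_costE; case: (costge z).
have [W [rho [mrho rhoE]]] := bit_codable_law pi (bit_codable_prod bX bY).
exists W, (fst \o rho), (snd \o rho); split.
- exact: (measurableT_comp measurable_fst mrho).
- exact: (measurableT_comp measurable_snd mrho).
- exact: image_law_comp measurable_fst rhoE piX.
- exact: image_law_comp measurable_snd rhoE piY.
- have [N [mN N0 hN']] := filterI aepsi (filterI aeomega aephi).
  exists (square_map rho @^-1` N); split.
  + exact: (preimage_measurable (measurable_square_map mrho)).
  + by rewrite -N0; exact: (image_law_square mrho rhoE).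
  + move=> z /= hz; apply: hN' => /= -[h1 [h2 h3]]; apply: hz.
    by split.
Qed.

Lemma FNGW_metric :
  is_metric_up_to (@weakly_isomorphic R p Omega Psi alpha beta)
    (@FNGW R p Omega Psi q alpha beta).
Proof.
have h2 : (0 <= (2^-1 : R)%:E)%E by rewrite lee_fin.
split.
- by move=> X Y; rewrite /FNGW fin_numM// inf_fin.
- by move=> X Y; rewrite /FNGW mule_ge0// inf_ge0.
- by move=> X Y; rewrite /FNGW; congr (_ * _)%E; apply/eqP;
  rewrite eq_le !inf_sym.
- move=> X Y Z; rewrite /FNGW -ge0_muleDr ?inf_ge0//.
  by apply: lee_wpmul2l => //; exact: inf_triangle.
- move=> X Y; rewrite /FNGW; split => [/eqP|iso].
    rewrite mule_eq0 => /orP[/eqP[/eqP]|/eqP]; first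
      by rewrite invr_eq0 pnatr_eq0.
    exact: inf0_weakly_isomorphic.
  by rewrite weakly_isomorphic_inf0// mule0.
Qed.

End Networks.

(** * Fused Gromov-Wasserstein tuples *)
Section FGWTuples.
Context {R : realType} {p : \bar R} {Psi : metricType R}.
Implicit Types X Y : FGW_tuple p Psi.

Lemma FGW_forget_omega (Omega : metricType R) (q beta : R)
    (X Y : Hnetwork p Omega Psi) :
  FNGW q 0 beta X Y = FGW q beta (forget_omega X) (forget_omega Y).
Proof.
rewrite /FNGW /FGW; congr (_ * ereal_inf _)%E.
suff e : @FNGW_cost R p Omega Psi q 0 beta X Y =
    @FGW_cost R p Psi q beta (forget_omega X) (forget_omega Y).
  by rewrite e.
by apply/funext => z; rewrite /FNGW_cost /FGW_cost subr0 mul0r addr0.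
Qed.

Lemma FGW_weakly_isomorphic_forget_omega (Omega : metricType R) (beta : R)
    (X Y : Hnetwork p Omega Psi) :
  weakly_isomorphic 0 beta X Y <->
  FGW_weakly_isomorphic beta (forget_omega X) (forget_omega Y).
Proof.
split=> -[W [rX [rY [mX mY lX lY iso]]]]; exists W, rX, rY; split => //.
- apply: filterS iso => w [h1 _ h3]; split => //.
  by rewrite -[in 1 - _](subr0 1).
- apply: filterS iso => w [h1 h3]; split => //; last by rewrite ltxx.
  by rewrite subr0.
Qed.

Lemma in_Lp_cst d (W : measurableType d) (P : probability W R)
    (S : metricType R) (s : S) : (1 <= p)%E -> in_Lp P p (fun _ : W => s).
Proof.
move=> p1; split; first exact: borel_fun_cst.
by exists s; rewrite mdistxx; exact: (Lnorm_cst_lty P p1 0).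
Qed.

(** Any separable metric space can play the role of Omega, with omega constant;
    Psi is one. *)
Lemma forget_omega_surjective (p1 : (1 <= p)%E) X :
  exists X' : Hnetwork p Psi Psi, forget_omega X' = X.
Proof.
case: X => X psi phi psiLp phiLp.
pose XX : probability (borel X * borel X)%type R := (pp_mu X \x pp_mu X)%E.
by exists (HNetwork psiLp phiLp (in_Lp_cst XX (psi point) p1)).
Qed.

End FGWTuples.

Theorem corollary30 (R : realType) (Omega Psi : metricType R)
    (hOmega : separable_space Omega) (hPsi : separable_space Psi)
    (p : \bar R) (hp : (1 <= p)%E) (q : R) (hq : 1 <= q)
    (alpha beta : R) (halpha : 0 <= alpha <= 1) (hbeta : 0 <= beta <= 1)
    (hab : alpha + beta <= 1) :
  is_metric_up_to
    (@weakly_isomorphic R p Omega Psi alpha beta)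
    (@FNGW R p Omega Psi q alpha beta) /\
  (forall X Y : Hnetwork p Omega Psi,
     FNGW q 0 beta X Y = FGW q beta (forget_omega X) (forget_omega Y)) /\
  is_metric_up_to
    (@FGW_weakly_isomorphic R p Psi beta)
    (@FGW R p Psi q beta).
Proof.
have [/andP[a0 _] /andP[b0 b1]] := (halpha, hbeta).
split; first exact: FNGW_metric.
split; first exact: FGW_forget_omega.
have ab1 : 0 + beta <= 1 by rewrite add0r.
have [hfin hge0 hsym htri h0] := FNGW_metric hPsi hPsi hp hq (lexx 0) b0 ab1.
have lift := @forget_omega_surjective R p Psi hp.
split.
- by move=> X Y; have [[X' <-] [Y' <-]] := (lift X, lift Y);
  rewrite -FGW_forget_omega.
- by move=> X Y; have [[X' <-] [Y' <-]] := (lift X, lift Y);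
  rewrite -FGW_forget_omega.
- move=> X Y; have [[X' <-] [Y' <-]] := (lift X, lift Y).
  by rewrite -!FGW_forget_omega.
- move=> X Y Z; have [[X' <-] [Y' <-]] := (lift X, lift Y).
  by have [Z' <-] := lift Z; rewrite -!FGW_forget_omega.
- move=> X Y; have [[X' <-] [Y' <-]] := (lift X, lift Y).
  rewrite -!FGW_forget_omega -FGW_weakly_isomorphic_forget_omega; exact: h0.
Qed.
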